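(* Let $s=[b,e]$ be a segment. For any $\mathfrak m\in\mathrm{DMult}^{\le's}$, $$(\mathrm{CT}_s(\mathfrak m))^t=\mathrm T_s(\mathfrak m^t).$$
   Context: $F$ is a non-archimedean local field of characteristic $0$. Fix a supercuspidal line; all segments are $[x,y]=\{\rho|\cdot|^x,\rho|\cdot|^{x+1},\dots,\rho|\cdot|^y\}$ with $\rho$ a fixed supercuspidal representation of some $\mathrm{GL}_m(F)$ and $x\le y$ real numbers in a fixed coset of $\mathbb Z$ in $\mathbb R$ (so combinatorially a segment is a finite non-empty interval of this coset). $b([x,y])=x$, $e([x,y])=y$; $[x,y]^+=[x,y+1]$, $[x,y]^-=[x,y-1]$ (empty if $x=y$; empty segments are discarded). Orders: $[x,y]>[x',y']$ iff $x>x'$, or $x=x'$ and $y<y'$; $[x,y]>'[x',y']$ iff $y>y'$, or $y=y'$ and $x<x'$. A multisegment is a finite multiset of segments, written additively; $\mathrm{Mult}$ is the set of multisegments. **Mœglin–Waldspurger dual $\mathfrak m\mapsto\mathfrak m^t$** (an involution). $\varnothing^t=\varnothing$. For $\mathfrak m\neq\varnothing$, let $\Delta_1$ be the largest (for $>$) segment of $\mathfrak m$ whose end is the maximal end of segments of $\mathfrak m$. Given $\Delta_i$, $\Delta_{i+1}$ is the largest (for $>$) segment of $\mathfrak m$ with $e(\Delta_{i+1})=e(\Delta_i)-1$ and $\Delta_{i+1}\le\Delta_i$; stop at $\Delta_k$ when no such segment exists. Put $\mathfrak m_1=[e(\Delta_k),e(\Delta_1)]$, $\mathfrak m^\#=\mathfrak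 m+\sum_{i=1}^k(\Delta_i^--\Delta_i)$, and $\mathfrak m^t=\mathfrak m_1+(\mathfrak m^\#)^t$. **Operators.** For a segment $s=[b,e]$, $\mathrm{Mult}^{\le's}$ is the set of multisegments all of whose segments $\Delta$ satisfy $\Delta\le's$; $\mathrm T_s:\mathrm{Mult}^{\le's}\to\mathrm{Mult}^{\le's}$, $\mathrm T_s(\mathfrak m)=\mathfrak m+s$; $\mathrm{DMult}^{\le's}=\{\mathfrak m^t:\mathfrak m\in\mathrm{Mult}^{\le's}\}$. For $\mathfrak m\in\mathrm{DMult}^{\le's}$, let $\Theta_1$ be the smallest (for $<$) segment of $\mathfrak m$ with $e(\Theta_1)=b-1$; given $\Theta_i$, let $\Theta_{i+1}$ be the smallest segment of $\mathfrak m$ with $e(\Theta_{i+1})=e(\Theta_i)+1$ and $\Theta_{i+1}>\Theta_i$; stop at $\Theta_l$ when no such segment exists ($l=0$ if no segment of $\mathfrak m$ ends at $b-1$). Then $$\mathrm{CT}_s(\mathfrak m)=\mathfrak m+\sum_{i=1}^l(\Theta_i^+-\Theta_i)+\sum_{j}[j,j],$$ where $j$ runs over the elements of $\{b,b+1,\dots,e\}$ with $j>e(\Theta_l)+1$ if $l\ge1$, and over all of $\{b,b+1,\dots,e\}$ if $l=0$. *)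

(* Defs.v *)
From HB Require Import structures.
From mathcomp Require Import all_boot all_order all_algebra.
From mathcomp Require Import finmap multiset reals.

Set Implicit Arguments.
Unset Strict Implicit.
Unset Printing Implicit Defensive.

Import Order.TTheory GRing.Theory Num.Theory.

Local Open Scope ring_scope.
Local Open Scope mset_scope.

(* With the supercuspidal rho fixed, the segment [x, y] on the line of rho is
   given by its ends x <= y, both in a fixed coset c + Z of Z in R. *)
Definition is_seg (R : realType) (c : R) : pred (R * R) :=
  fun p => [&& p.1 - c \is a Num.int, p.2 - c \is a Num.int & p.1 <= p.2].

Record seg (R : realType) (c : R) :=
  Seg { seg_ends : R * R; segP : is_seg c seg_ends }.

HB.instance Definition _ (R : realType) (c : R) := [isSub for @seg_ends R c].
HB.instance Definition _ (R : realType) (c : R) := [Choice of seg c by <:].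

Notation mult c := {mset seg c}.

Section Segments.
Variables (R : realType) (c : R).
Implicit Types (D s : seg c) (m : mult c).

Definition sb D : R := (seg_ends D).1.
Definition se D : R := (seg_ends D).2.

Definition seg_gt D D' : bool :=
  (sb D > sb D') || ((sb D == sb D') && (se D < se D')).
Definition seg_ge D D' : bool := (D == D') || seg_gt D D'.

Definition seg_gt' D D' : bool :=
  (se D > se D') || ((se D == se D') && (sb D < sb D')).
Definition seg_ge' D D' : bool := (D == D') || seg_gt' D D'.

(* None when the sequence is empty. *)
Definition largest (ds : seq (seg c)) : option (seg c) :=
  ohead [seq D <- ds | all (fun D' => seg_ge D D') ds].
Definition smallest (ds : seq (seg c)) : option (seg c) :=
  ohead [seq D <- ds | all (fun D' => seg_ge D' D) ds].

(* The sum of the [x, y] for (x, y) in ps; the empty ones, y < x, are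
   discarded by insub. *)
Definition segs (ps : seq (R * R)) : mult c := seq_mset (pmap insub ps).

End Segments.

(* x, f x, f (f x), ... for o = Some x, until f returns None, with at most n
   terms. *)
Fixpoint iterates (T : Type) (f : T -> option T) (n : nat) (o : option T) :
    seq T :=
  match n, o with
  | n'.+1, Some x => x :: iterates f n' (f x)
  | _, _ => [::]
  end.

Section Dual.
Variables (R : realType) (c : R).
Implicit Types (D s : seg c) (m : mult c).

Definition mw_first m : option (seg c) :=
  largest [seq D <- m | all (fun D' => se D' <= se D) m].

Definition mw_next m D : option (seg c) :=
  largest [seq D' <- m | (se D' == se D - 1) && seg_ge D D'].

(* The bound size m is never reached before the chain stops by itself: see
   mw_chain_stop. *)
Definition mw_chain m : seq (seg c) :=
  iterates (mw_next m) (size m) (mw_first m).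

Definition mw_sharp m : mult c :=
  (m `\` seq_mset (mw_chain m))
    `+` segs c [seq (sb D, se D - 1) | D <- mw_chain m].

Definition mw_head m : mult c :=
  if mw_chain m is D1 :: Ds then segs c [:: (se (last D1 Ds), se D1)]
  else mset0.

Definition seg_length D : nat := (Num.truncn (se D - sb D)).+1.

Definition mult_length m : nat := (\sum_(D <- m) seg_length D)%N.

Fixpoint mw_dual_rec (n : nat) m : mult c :=
  if n is n'.+1 then
    if m == mset0 then mset0 else mw_head m `+` mw_dual_rec n' (mw_sharp m)
  else mset0.

(* The recursion depth is bounded by the total length, which decreases from m
   to mw_sharp m; mw_dual0 and mw_dualE are the defining equations. *)
Definition mw_dual m : mult c := mw_dual_rec (mult_length m) m.

Definition Mult_le' s m : Prop := forall D, D \in m -> seg_ge' s D.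

Definition DMult_le' s m : Prop := exists2 n, Mult_le' s n & m = mw_dual n.

(* T_s and CT_s are meant on Mult_le' s and DMult_le' s respectively; the
   same formulas define them everywhere. *)
Definition T_op s m : mult c := m `+` [mset s].

Definition ct_first s m : option (seg c) :=
  smallest [seq D <- m | se D == sb s - 1].

Definition ct_next m D : option (seg c) :=
  smallest [seq D' <- m | (se D' == se D + 1) && seg_gt D' D].

(* As for mw_chain, the bound size m is harmless: see ct_chain_stop. *)
Definition ct_chain s m : seq (seg c) :=
  iterates (ct_next m) (size m) (ct_first s m).

Definition seg_points s : seq R :=
  [seq sb s + i%:R | i <- iota 0 (seg_length s)].

Definition ct_points s m : seq R :=
  if ct_chain s m is D1 :: Ds
  then [seq j <- seg_points s | j > se (last D1 Ds) + 1]
  else seg_points s.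

Definition CT_op s m : mult c :=
  (m `\` seq_mset (ct_chain s m))
    `+` segs c [seq (sb D, se D + 1) | D <- ct_chain s m]
    `+` segs c [seq (j, j) | j <- ct_points s m].

End Dual.

Section Recursion.
Variables (R : realType) (c : R).
Implicit Types (D s : seg c) (m : mult c).

Lemma seg_inj D D' : sb D = sb D' -> se D = se D' -> D = D'.
Proof.
move=> hb he; apply: val_inj; move: hb he; rewrite /sb /se /=.
by case: (seg_ends D) (seg_ends D') => [x y] [x' y'] /= -> ->.
Qed.

Lemma seg_ge_total : total (@seg_ge R c).
Proof.
move=> D D'; rewrite /seg_ge /seg_gt.
case: (ltgtP (sb D) (sb D')) => hb; rewrite ?orbT //=.
case: (ltgtP (se D) (se D')) => he; rewrite ?orbT //=.
by rewrite (seg_inj hb he) eqxx.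
Qed.

Lemma seg_ge_trans : transitive (@seg_ge R c).
Proof.
move=> D2 D1 D3; rewrite /seg_ge /seg_gt.
have [<- //|_ /=] := eqVneq D1 D2; have [<- -> //|_ /=] := eqVneq D2 D3.
  by rewrite orbT.
move=> h12 h23; apply/orP; right.
case/orP: h12 => [h12|/andP[/eqP h12 e12]];
  case/orP: h23 => [h23|/andP[/eqP h23 e23]].
- by rewrite (lt_trans h23 h12).
- by rewrite -h23 h12.
- by rewrite h12 h23.
- by rewrite h12 h23 eqxx (lt_trans e12 e23) orbT.
Qed.

Lemma extremum_spec (T : eqType) (r : rel T) (l : seq T) :
    total r -> transitive r ->
  if ohead [seq x <- l | all (r x) l] is Some x
  then x \in l /\ {in l, forall y, r x y} else l = [::].
Proof.
move=> rtot rtr; have rxx x : r x x by have := rtot x x; rewrite orbb.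
have [-> //|l0] := eqVneq l [::].
have: has (fun x => all (r x) l) l.
  elim: l l0 => //= a l IH _; have [->|/IH/hasP[x xl /allP hx]] := eqVneq l [::].
    by rewrite /= rxx.
  case: (boolP (r a x)) => hax /=.
    apply/orP; left; rewrite rxx; apply/allP => y /hx; exact: rtr hax.
  apply/orP; right; apply/hasP; exists x => //.
  by rewrite (_ : r x a) /=; [apply/allP | have := rtot a x; rewrite (negPf hax)].
rewrite has_filter; case E: [seq x <- l | all (r x) l] => [|x u] //= _.
have: x \in [seq x <- l | all (r x) l] by rewrite E mem_head.
by rewrite mem_filter => /andP[/allP].
Qed.

Lemma largestP (ds : seq (seg c)) :
  if largest ds is Some D then D \in ds /\ {in ds, forall D', seg_ge D D'}
  else ds = [::].
Proof. exact: extremum_spec seg_ge_total seg_ge_trans. Qed.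

Lemma smallestP (ds : seq (seg c)) :
  if smallest ds is Some D then D \in ds /\ {in ds, forall D', seg_ge D' D}
  else ds = [::].
Proof.
apply: (@extremum_spec _ (fun D D' => seg_ge D' D)).
  by move=> D D'; exact: seg_ge_total.
by move=> D2 D1 D3 h12 h23; exact: seg_ge_trans h23 h12.
Qed.

Lemma iterates_stop (T : eqType) (f : T -> option T) (k : T -> R) (l : seq T)
    o x u :
    (forall y, o = Some y -> y \in l) ->
    (forall y z, f y = Some z -> z \in l /\ k z < k y) ->
    iterates f (size l) o = x :: u ->
  [/\ f (last x u) = None, uniq (x :: u) & {subset x :: u <= l}].
Proof.
move=> ol fP; case: {2 3}(size l) (erefl (size l)) => [|n] // szl.
case: o ol => //= y0 /(_ _ erefl) xl [ey <-]; rewrite {}ey in xl *.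
have main n' y : y \in l ->
    [/\ path (fun a b => k b < k a) y (iterates f n' (f y)),
        {subset y :: iterates f n' (f y) <= l} &
        size (iterates f n' (f y)) = n' \/ f (last y (iterates f n' (f y))) = None].
  elim: n' y => [|n' IH] y yl /=.
    by split=> //; [move=> z; rewrite inE => /eqP->|left].
  case E: (f y) => [z|] /=; last by split=> //; [move=> z; rewrite inE => /eqP->|right].
  have [zl ->] := fP _ _ E; have [-> sub d] := IH z zl; split=> //.
    by move=> a; rewrite inE => /orP[/eqP->//|/sub].
  by case: d => [->|d]; [left|right].
have [pth sub d] := main n x xl.
have uq a t : path (fun a b => k b < k a) a t -> uniq (a :: t).
  have tr : transitive (fun a b => k b < k a).
    by move=> b1 b2 b3 h1 h2; exact: lt_trans h2 h1.
  have ir : irreflexive (fun a b => k b < k a) by move=> b; exact: ltxx.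
  exact: (@sorted_uniq _ _ tr ir (a :: t)).
split=> //; last exact: uq.
case: d => // szn; case E: (f _) => [z|] //; have [zl zlt] := fP _ _ E.
have pth' : path (fun a b => k b < k a) x (rcons (iterates f n (f x)) z).
  by rewrite rcons_path pth zlt.
have sub' : {subset x :: rcons (iterates f n (f x)) z <= l}.
  by move=> a; rewrite -rcons_cons mem_rcons inE => /orP[/eqP->//|/sub].
by have := uniq_leq_size (uq _ _ pth') sub'; rewrite /= size_rcons szn szl ltnn.
Qed.

Lemma mw_chainP m D Ds : mw_chain m = D :: Ds ->
  [/\ mw_next m (last D Ds) = None, uniq (D :: Ds) & {subset D :: Ds <= m}].
Proof.
apply: (@iterates_stop _ _ (@se R c)) => [y|y z].
  rewrite /mw_first => E; have := largestP [seq D <- m | all (fun D' => se D' <= se D) m].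
  by rewrite E mem_filter => -[/andP[]].
rewrite /mw_next => E.
have := largestP [seq D' <- m | (se D' == se y - 1) && seg_ge y D'].
rewrite E mem_filter => -[/andP[/andP[/eqP -> _] ->] _].
by rewrite ltrBlDr ltrDl ltr01.
Qed.

Lemma mw_chain_stop m D Ds :
  mw_chain m = D :: Ds -> mw_next m (last D Ds) = None.
Proof. by case/mw_chainP. Qed.

Lemma ct_chain_stop s m D Ds :
  ct_chain s m = D :: Ds -> ct_next m (last D Ds) = None.
Proof.
suff P : (forall y, ct_first s m = Some y -> y \in enum_mset m) /\
    (forall y z, ct_next m y = Some z -> z \in enum_mset m /\ - se z < - se y).
  by case: P => P1 P2 /(iterates_stop P1 P2)[].
split=> [y|y z].
  rewrite /ct_first => E; have := smallestP [seq D <- m | se D == sb s - 1].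
  by rewrite E mem_filter => -[/andP[]].
rewrite /ct_next => E.
have := smallestP [seq D' <- m | (se D' == se y + 1) && seg_gt D' y].
rewrite E mem_filter => -[/andP[/andP[/eqP -> _] ->] _].
by rewrite ltrN2 ltrDl ltr01.
Qed.

Lemma mw_chain_nil m : mw_chain m = [::] -> m = mset0.
Proof.
have [//|m0] := eqVneq m mset0; rewrite /mw_chain /mw_first.
have [D Dm]: exists D, D \in m.
  case E: (enum_mset m) => [|D u]; last first.
    by exists D; rewrite -[D \in m]/(D \in enum_mset m) E mem_head.
  by case/eqP: m0; apply/msetP => D; rewrite mset0E -count_mem_mset E.
have szm : (0 < size (enum_mset m))%N.
  by move: Dm; rewrite -[D \in m]/(D \in enum_mset m); case: (enum_mset m).
have rtot : total (fun D D' => se D' <= se D) by move=> D1 D2; exact: le_total.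
have rtr : transitive (fun D D' => se D' <= se D).
  by move=> D2 D1 D3 h12 h23; exact: le_trans h23 h12.
have := extremum_spec m rtot rtr; have := largestP [seq D <- m | all (fun D' => se D' <= se D) m].
case: largest => [D1 _ _|->]; first by case: (size _) szm.
by move=> /= m_nil; rewrite m_nil in szm.
Qed.

Lemma mult_length_perm (A B : seq (seg c)) m : perm_eq m (A ++ B) -> 
  mult_length m = (\sum_(D <- A) seg_length D + \sum_(D <- B) seg_length D)%N.
Proof. by move=> h; rewrite /mult_length (perm_big _ h) big_cat. Qed.

Lemma mult_lengthD m m' :
  mult_length (m `+` m') = (mult_length m + mult_length m')%N.
Proof.
apply: mult_length_perm; apply/allP => D _ /=.
by rewrite count_cat !count_mem_mset msetE2.
Qed.

Lemma mult_length_seq_mset (l : seq (seg c)) :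
  mult_length (seq_mset l) = (\sum_(D <- l) seg_length D)%N.
Proof. exact: perm_big (perm_eq_seq_mset l). Qed.

Lemma seg_length_minus D :
  (mult_length (segs c [:: (sb D, se D - 1)%R]) < seg_length D)%N.
Proof.
rewrite mult_length_seq_mset /=; case: insubP => [D'|] /=; last first.
  by rewrite big_nil.
move=> /and3P[_ _ /= le1] e; rewrite big_seq1 /seg_length /sb /se e /=.
rewrite -/(sb D) -/(se D) ltnS truncn_gt_nat -natr1 -lerBrDr addrAC.
by rewrite truncn_le addrAC subr_ge0.
Qed.

Lemma mult_length_segs_map (f : seg c -> R * R) (l : seq (seg c)) :
  mult_length (segs c (map f l)) =
  (\sum_(D <- l) mult_length (segs c [:: f D]))%N.
Proof.
elim: l => [|D l IH]; first by rewrite mult_length_seq_mset !big_nil.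
rewrite big_cons -IH !mult_length_seq_mset /=.
by case: insub => [D'|] /=; rewrite ?big_cons ?big_nil ?addn0.
Qed.

Lemma mult_length_sharp m :
  m != mset0 -> (mult_length (mw_sharp m) < mult_length m)%N.
Proof.
move=> m0; case E: (mw_chain m) => [|D Ds].
  by rewrite (mw_chain_nil E) eqxx in m0.
have [_ uq sub] := mw_chainP E.
have le_m : seq_mset (D :: Ds) `<=` m.
  apply/msubsetP => D'; rewrite mset_seqE count_uniq_mem //.
  by case: (boolP (D' \in _)) => // /sub; rewrite -mset_gt0.
have {2}-> : m = (m `\` seq_mset (D :: Ds)) `+` seq_mset (D :: Ds).
  by rewrite msetBDK.
rewrite /mw_sharp E !mult_lengthD ltn_add2l mult_length_segs_map.
rewrite mult_length_seq_mset !big_cons -addSn leq_add ?seg_length_minus //.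
by apply: leq_sum => D' _; exact: ltnW (seg_length_minus D').
Qed.

Lemma mw_dual0 : mw_dual (mset0 : mult c) = mset0.
Proof. by rewrite /mw_dual; case: mult_length => //= n; rewrite eqxx. Qed.

Lemma mw_dualE m :
  m != mset0 -> mw_dual m = mw_head m `+` mw_dual (mw_sharp m).
Proof.
have main n n' m' : (mult_length m' <= n -> mult_length m' <= n' ->
    mw_dual_rec n m' = mw_dual_rec n' m')%N.
  elim: n n' m' => [|n IH] [|n'] m' //=; case: eqVneq => // m0 hn hn'.
  - by have := mult_length_sharp m0; case: mult_length hn.
  - by have := mult_length_sharp m0; case: mult_length hn'.
  congr (_ `+` _); have lt := mult_length_sharp m0.
  by apply: IH; rewrite -ltnS; apply: leq_trans lt _.
move=> m0; have lt := mult_length_sharp m0; rewrite /mw_dual.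
case E: (mult_length m) lt => [|n] //= lt; rewrite (negPf m0).
by congr (_ `+` _); apply: main.
Qed.

End Recursion.

(* Main.v *)
(* Index the segments by pairs i < j of points of the line, [i, j - 1] being
   (i, j), and see a multisegment as the array x of its multiplicities.  All the
   steps of the Moeglin-Waldspurger algorithm with a given maximal end, and
   hence the whole duality, are a composite of the local moves
     (x_ij, x_jk, x_ik) |-> (x_ij + x_ik - w, x_jk + x_ik - w, w),
     w = min(x_ij, x_jk),
   over the triples i < j < k in reverse lexicographic order: the scan of the
   triples (i, j, k) with k fixed transports the defect left by one chain of
   segments, and turns it into one more unit on the head of that chain.  The
   moves are involutive and satisfy the tetrahedron equation, so the composite
   can be read in either direction, and the duality is an involution.

   Given this, CT_s inverts one step of the algorithm: the points j, followed by
   the Theta_i^+ in reverse order, form the greedy chain of CT_s m, with head s,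
   and truncating it gives m back.  This fails only if Theta_l ends at the end
   of s; then the Theta_i form a ladder in m, the first head of m starts before
   s and has the end of s, and it belongs to m^t, which is <=' s by involutivity. *)
Require Import Defs.
From mathcomp Require Import all_boot all_order all_algebra.
From mathcomp Require Import finmap multiset reals.
From mathcomp Require Import boolp zify lra.

Set Implicit Arguments.
Unset Strict Implicit.
Unset Printing Implicit Defensive.

(** * The local moves and the tetrahedron equation *)

Definition triple : Type := (nat * nat * nat)%type.
Definition arr := (nat * nat)%type -> nat.

Definition toggle (t : triple) (x : arr) : arr := fun p =>
  let: (i, j, k) := t in
  let w := minn (x (i, j)) (x (j, k)) in
  if p == (i, j) then x (i, j) + x (i, k) - w
  else if p == (j, k) then x (j, k) + x (i, k) - w
  else if p == (i, k) then w
  else x p.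

Definition run (l : seq triple) (x : arr) : arr := foldl (fun y t => toggle t y) x l.

Definition wires (t : triple) : seq (nat * nat) :=
  let: (i, j, k) := t in [:: (i, j); (j, k); (i, k)].

Definition lt3 (t : triple) : bool := let: (i, j, k) := t in i < j < k.

Lemma run_cat l1 l2 x : run (l1 ++ l2) x = run l2 (run l1 x).
Proof. exact: foldl_cat. Qed.

Lemma run_rcons l t x : run (rcons l t) x = toggle t (run l x).
Proof. by rewrite -cats1 run_cat. Qed.

Lemma toggle_off t x p : p \notin wires t -> toggle t x p = x p.
Proof.
case: t => [[i j] k] /=; rewrite !inE !negb_or => /and3P[/negPf-> /negPf-> /negPf->].
by [].
Qed.

Lemma toggle_on t x y p :
  {in wires t, x =1 y} -> p \in wires t -> toggle t x p = toggle t y p.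
Proof.
move=> xy pt; have xyp := xy p pt; case: t xy pt => [[i j] k] /= xy _.
have -> : x (i, j) = y (i, j) by apply: xy; rewrite !inE eqxx.
have -> : x (j, k) = y (j, k) by apply: xy; rewrite !inE eqxx orbT.
have -> : x (i, k) = y (i, k) by apply: xy; rewrite !inE eqxx !orbT.
by rewrite xyp.
Qed.

(** The smaller of the entries at [(i, j)] and [(j, k)] becomes the old [x (i, k)], which a second
    move therefore finds as its minimum. Subtraction never truncates, since [w] is at most both
    entries. *)
Lemma toggleK t : lt3 t -> involutive (toggle t).
Proof.
case: t => [[i j] k] /andP[ij jk] x; apply/funext => -[a b].
rewrite /toggle !xpair_eqE !eqxx /=.
have -> : (j == i) = false by lia.
have -> : (k == j) = false by lia.
have -> : (i == j) = false by lia.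
rewrite /=; case: ifP => [/andP[/eqP-> /eqP->]|-> /=]; first lia.
case: ifP => [/andP[/eqP-> /eqP->]|-> /=]; first lia.
by case: ifP => [/andP[/eqP-> /eqP->]|-> //]; lia.
Qed.

Lemma run_revK l : all lt3 l -> cancel (run l) (run (rev l)).
Proof.
elim: l => //= t l IH /andP[tlt /IH lK] x.
by rewrite rev_cons run_rcons lK toggleK.
Qed.

(** * Commutation of moves on disjoint wires *)

Definition apart (t u : triple) : bool := ~~ has (mem (wires t)) (wires u).

Lemma apartP t u p : apart t u -> p \in wires u -> p \notin wires t.
Proof. by move=> /hasPn h /h. Qed.

Lemma toggleC t u x : apart t u -> toggle u (toggle t x) = toggle t (toggle u x).
Proof.
move=> tu; apply/funext => p.
have ut q : q \in wires t -> q \notin wires u.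
  by move=> qt; apply/negP => /(apartP tu); rewrite qt.
case: (boolP (p \in wires u)) => pu.
  rewrite (toggle_off _ (apartP tu pu)); apply: toggle_on => // q qu.
  by rewrite toggle_off // (apartP tu).
rewrite (toggle_off _ pu); case: (boolP (p \in wires t)) => pt.
  apply: toggle_on => // q qt.
  by rewrite toggle_off // ut.
by rewrite !toggle_off.
Qed.

Lemma runC l1 l2 x :
  (forall t u, t \in l1 -> u \in l2 -> apart t u) ->
  run l2 (run l1 x) = run l1 (run l2 x).
Proof.
elim: l1 x => //= t l1 IH x h.
rewrite IH; last by move=> t' u t'l ul; apply: h => //; rewrite inE t'l orbT.
congr run; have {IH} : forall u, u \in l2 -> apart t u.
  by move=> u; apply: h; rewrite mem_head.
elim: l2 x {h} => //= u l2 IH x h.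
rewrite -IH; last by move=> v vl; apply: h; rewrite inE vl orbT.
by rewrite toggleC // h // mem_head.
Qed.

(** Yields [w3 + w4 = v1 + v2] in the notation of [tetrahedron_nat] and, with the line reversed,
    [v3 + v4 = w1 + w2]. Together with [w3 = v3] these leave only linear arithmetic. *)
Lemma tetrahedron_min (a b d e f : nat) :
  minn (a + minn b (f + e - minn d f)) (d + e - minn d f + minn a (minn d f)) =
  minn (a + b) (e + minn a d).
Proof. by case: (leqP d f) => df; case: (leqP a d) => ad; lia. Qed.

(* a, b, c, d, e, f are the values at ij, ik, il, jk, jl, kl, and w1, ..., w4 and
   v1, ..., v4 the minima taken by the successive moves of the two sides. *)
Lemma tetrahedron_nat (a b c d e f w1 w2 w3 w4 v1 v2 v3 v4 : nat) :
  w1 = minn d f -> w2 = minn b (f + e - w1) -> w3 = minn a w1 ->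
  w4 = minn (a + w2 - w3) (d + e - w1) ->
  v1 = minn a d -> v2 = minn (a + b - v1) e -> v3 = minn v1 f ->
  v4 = minn (d + b - v1) (f + v2 - v3) ->
  a + w2 - w3 + (b + c - w2) - w4 = a + b - v1 + c - v2 /\
  w4 = v1 + v2 - v3 /\
  w3 = v3 /\
  d + e - w1 + (b + c - w2) - w4 = d + b - v1 + (e + c - v2) - v4 /\
  w1 + w2 - w3 = v4 /\
  f + e - w1 + c - w2 = f + v2 - v3 + (e + c - v2) - v4.
Proof.
move=> h1 h2 h3 h4 g1 g2 g3 g4.
have wv3 : w3 = v3 by rewrite g3 g1 h3 h1 minnA.
have e1 : minn (a + w2) (d + e - w1 + w3) = minn (a + b) (e + v1).
  by rewrite h2 h3 g1 h1 tetrahedron_min.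
have e2 : minn (f + v2) (d + b - v1 + v3) = minn (f + e) (b + w1).
  have := tetrahedron_min f e d b a.
  by rewrite [minn d a]minnC -g1 [minn e _]minnC [minn f v1]minnC -g2 -g3
             [minn f d]minnC -h1.
have b1 : w1 <= d by rewrite h1 geq_minl.
have b2 : w1 <= f by rewrite h1 geq_minr.
have b3 : w2 <= b by rewrite h2 geq_minl.
have b4 : w3 <= a by rewrite h3 geq_minl.
have b5 : w3 <= w1 by rewrite h3 geq_minr.
have b6 : v1 <= a by rewrite g1 geq_minl.
have b7 : v1 <= d by rewrite g1 geq_minr.
have b8 : v2 <= e by rewrite g2 geq_minr.
have e3 : w4 + w3 = v1 + v2.
  have -> : w4 + w3 = minn (a + w2) (d + e - w1 + w3).
    by rewrite h4; clear -b4 b1 b5; lia.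
  by rewrite e1 g2; clear -b6; lia.
have e4 : v4 + v3 = w1 + w2.
  have -> : v4 + v3 = minn (f + v2) (d + b - v1 + v3).
    by rewrite g4; clear -wv3 b2 b5; lia.
  by rewrite e2 h2; clear -b2; lia.
have b9 : w4 <= d + e - w1 by rewrite h4 geq_minr.
have b10 : v4 <= d + b - v1 by rewrite g4 geq_minl.
have b11 : w2 <= f + e - w1 by rewrite h2 geq_minr.
have b12 : v2 <= a + b - v1 by rewrite g2 geq_minl.
have b13 : w4 <= a + w2 - w3 by rewrite h4 geq_minl.
have b14 : v4 <= f + v2 - v3 by rewrite g4 geq_minr.
clear h1 h2 h3 h4 g1 g2 g3 g4 e1 e2.
repeat split; lia.
Qed.

Arguments toggle : simpl never.

Lemma toggle_wires i j k x : i < j -> j < k ->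
  let w := minn (x (i, j)) (x (j, k)) in
  (toggle (i, j, k) x (i, j) = x (i, j) + x (i, k) - w) *
  (toggle (i, j, k) x (j, k) = x (j, k) + x (i, k) - w) *
  (toggle (i, j, k) x (i, k) = w).
Proof.
move=> ij jk; rewrite /toggle !xpair_eqE !eqxx /=.
have [-> -> ->] : [/\ (j == i) = false, (k == j) = false & (i == j) = false].
  by split; lia.
by [].
Qed.

Lemma tetrahedron i j k l x : i < j -> j < k -> k < l ->
  toggle (i, j, k) (toggle (i, j, l) (toggle (i, k, l) (toggle (j, k, l) x))) =
  toggle (j, k, l) (toggle (i, k, l) (toggle (i, j, l) (toggle (i, j, k) x))).
Proof.
move=> ij jk kl; apply/funext => p.
have [ik jl] : i < k /\ j < l by lia.
set y1 := toggle (j, k, l) x; set y2 := toggle (i, k, l) y1.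
set y3 := toggle (i, j, l) y2; set y4 := toggle (i, j, k) y3.
set z1 := toggle (i, j, k) x; set z2 := toggle (i, j, l) z1.
set z3 := toggle (i, k, l) z2; set z4 := toggle (j, k, l) z3.
have [off|on] := boolP (p \notin [:: (i, j); (i, k); (i, l); (j, k); (j, l); (k, l)]).
  by move: off; rewrite !inE => off;
     rewrite /y4 /y3 /y2 /y1 /z4 /z3 /z2 /z1 !toggle_off //= !inE; lia.
have a1 := toggle_wires x jk kl; have b1 := toggle_wires x ij jk.
have a2 := toggle_wires y1 ik kl; have b2 := toggle_wires z1 ij jl.
have a3 := toggle_wires y2 ij jl; have b3 := toggle_wires z2 ik kl.
have a4 := toggle_wires y3 ij jk; have b4 := toggle_wires z3 jk kl.
rewrite -/y1 -/y2 -/y3 -/y4 -/z1 -/z2 -/z3 -/z4 /= in a1 a2 a3 a4 b1 b2 b3 b4.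
have o t y a b : (a, b) \notin wires t -> toggle t y (a, b) = y (a, b).
  exact: toggle_off.
have c1 : (y1 (i, j) = x (i, j)) * (y1 (i, k) = x (i, k)) * (y1 (i, l) = x (i, l)).
  by do !split; apply: o; rewrite /= !inE !xpair_eqE; lia.
have c2 : (y2 (i, j) = y1 (i, j)) * (y2 (j, k) = y1 (j, k)) * (y2 (j, l) = y1 (j, l)).
  by do !split; apply: o; rewrite /= !inE !xpair_eqE; lia.
have c3 : (y3 (i, k) = y2 (i, k)) * (y3 (j, k) = y2 (j, k)) * (y3 (k, l) = y2 (k, l)).
  by do !split; apply: o; rewrite /= !inE !xpair_eqE; lia.
have c4 : (y4 (i, l) = y3 (i, l)) * (y4 (j, l) = y3 (j, l)) * (y4 (k, l) = y3 (k, l)).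
  by do !split; apply: o; rewrite /= !inE !xpair_eqE; lia.
have d1 : (z1 (i, l) = x (i, l)) * (z1 (j, l) = x (j, l)) * (z1 (k, l) = x (k, l)).
  by do !split; apply: o; rewrite /= !inE !xpair_eqE; lia.
have d2 : (z2 (i, k) = z1 (i, k)) * (z2 (j, k) = z1 (j, k)) * (z2 (k, l) = z1 (k, l)).
  by do !split; apply: o; rewrite /= !inE !xpair_eqE; lia.
have d3 : (z3 (i, j) = z2 (i, j)) * (z3 (j, k) = z2 (j, k)) * (z3 (j, l) = z2 (j, l)).
  by do !split; apply: o; rewrite /= !inE !xpair_eqE; lia.
have d4 : (z4 (i, j) = z3 (i, j)) * (z4 (i, k) = z3 (i, k)) * (z4 (i, l) = z3 (i, l)).
  by do !split; apply: o; rewrite /= !inE !xpair_eqE; lia.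
have [ha [hb [hc [hd [he hf]]]]] :=
  @tetrahedron_nat (x (i, j)) (x (i, k)) (x (i, l)) (x (j, k)) (x (j, l)) (x (k, l))
    _ _ _ _ _ _ _ _ erefl erefl erefl erefl erefl erefl erefl erefl.
clearbody y1 y2 y3 y4 z1 z2 z3 z4.
(* All values of the intermediate arrays, as one rewriting rule that brings each wire back to
   entries of [x]. *)
pose e := (a1, a2, a3, a4, b1, b2, b3, b4, c1, c2, c3, c4, d1, d2, d3, d4).
move: on; rewrite negbK !inE => /orP[/eqP->|]; first by rewrite !e; exact: ha.
case/orP=> [/eqP->|]; first by rewrite !e; exact: hb.
case/orP=> [/eqP->|]; first by rewrite !e; exact: hc.
case/orP=> [/eqP->|]; first by rewrite !e; exact: hd.
case/orP=> [/eqP->|/eqP->]; first by rewrite !e; exact: he.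
by rewrite !e; exact: hf.
Qed.

(* row k j i, phase k j and triples n list in reverse lexicographic order on
   (third, second, first) the triples (i', j, k) with i' < i, the triples
   i' < j' < k with j' < j, and the triples i' < j' < k' with k' < n. *)
Fixpoint row (k j i : nat) : seq triple :=
  if i is i'.+1 then (i', j, k) :: row k j i' else [::].

Fixpoint phase (k j : nat) : seq triple :=
  if j is j'.+1 then row k j' j' ++ phase k j' else [::].

Fixpoint triples (n : nat) : seq triple :=
  if n is k.+1 then phase k k ++ triples k else [::].

Lemma mem_row k j i a b c : ((a, b, c) \in row k j i) = [&& a < i, b == j & c == k].
Proof.
elim: i => [|i IH] /=; first by [].
rewrite inE IH !xpair_eqE; lia.
Qed.

Lemma mem_phase k j a b c : ((a, b, c) \in phase k j) = [&& a < b, b < j & c == k].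
Proof.
elim: j => [|j IH] /=; first by rewrite andbF.
rewrite mem_cat IH mem_row; lia.
Qed.

Lemma mem_triples n a b c : ((a, b, c) \in triples n) = [&& a < b, b < c & c < n].
Proof.
elim: n => [|n IH] /=; first by rewrite !andbF.
rewrite mem_cat IH mem_phase; lia.
Qed.

Lemma lt3_triples n : all lt3 (triples n).
Proof. by apply/allP => -[[a b] c]; rewrite mem_triples /= => /and3P[-> ->]. Qed.

Lemma apartE i j k i' j' k' : apart (i, j, k) (i', j', k') =
  [&& (i', j') \notin wires (i, j, k), (j', k') \notin wires (i, j, k) &
      (i', k') \notin wires (i, j, k)].
Proof. by rewrite /apart -all_predC /= andbT. Qed.

(** Disjointness of the wires of two scans, turned by the membership lemmas into linear arithmetic
    on the indices. *)
Ltac commute :=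
  apply: runC; case=> [[? ?] ?] [[? ?] ?];
  rewrite ?mem_rev ?mem_seq1 ?mem_row ?mem_phase ?mem_triples apartE /= ?inE ?xpair_eqE
    => ? ?; lia.

(** * The composite equals its reversal *)

Lemma run_rowE k j i x : run (row k j i.+1) x = run (row k j i) (toggle (i, j, k) x).
Proof. by []. Qed.

Lemma run_phaseE k j x : run (phase k j.+1) x = run (phase k j) (run (row k j j) x).
Proof. exact: run_cat. Qed.

Lemma run_triplesE k x : run (triples k.+1) x = run (triples k) (run (phase k k) x).
Proof. exact: run_cat. Qed.

(** One tetrahedron for each first index below [i] carries the move at [(j, k, n)] through the three
    rows and reverses their order. The moves exchanged on the way share no wire. *)
Lemma run_row_tetrahedron n k j i x : i <= j -> j < k -> k < n ->
  run (row k j i) (run (row n j i) (run (row n k i) (toggle (j, k, n) x))) =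
  toggle (j, k, n) (run (row n k i) (run (row n j i) (run (row k j i) x))).
Proof.
move=> ij jk kn; elim: i x ij => [x _|i IH x ij]; first exact: erefl.
have {}IH y := IH y (ltnW ij).
have c1 y : toggle (i, j, n) (run (row n k i) y) = run (row n k i) (toggle (i, j, n) y).
  by rewrite -![toggle _ _]/(run [:: _] _); commute.
have c2 y : toggle (i, j, k) (run (row n k i) y) = run (row n k i) (toggle (i, j, k) y).
  by rewrite -![toggle _ _]/(run [:: _] _); commute.
have c3 y : toggle (i, j, k) (run (row n j i) y) = run (row n j i) (toggle (i, j, k) y).
  by rewrite -![toggle _ _]/(run [:: _] _); commute.
have c4 y : toggle (i, k, n) (run (row k j i) y) = run (row k j i) (toggle (i, k, n) y).
  by rewrite -![toggle _ _]/(run [:: _] _); commute.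
have c5 y : toggle (i, k, n) (run (row n j i) y) = run (row n j i) (toggle (i, k, n) y).
  by rewrite -![toggle _ _]/(run [:: _] _); commute.
have c6 y : toggle (i, j, n) (run (row k j i) y) = run (row k j i) (toggle (i, j, n) y).
  by rewrite -![toggle _ _]/(run [:: _] _); commute.
by rewrite !run_rowE c3 c1 c2 tetrahedron // IH c6 c5 c4.
Qed.

(** The moves of [row n k j] cross the two phases one at a time by [run_row_tetrahedron]: the row
    comes out reversed and the phases change places. *)
Lemma run_phase_tetrahedron n k j x : j <= k -> k < n ->
  run (phase k j) (run (phase n j) (run (row n k j) x)) =
  run (rev (row n k j)) (run (phase n j) (run (phase k j) x)).
Proof.
move=> jk kn; elim: j x jk => [x _|j IH x jk]; first exact: erefl.
have {}IH y := IH y (ltnW jk).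
have c1 y : run (row k j j) (run (phase n j) y) = run (phase n j) (run (row k j j) y).
  by commute.
have c2 y : toggle (j, k, n) (run (phase n j) y) = run (phase n j) (toggle (j, k, n) y).
  by rewrite -![toggle _ _]/(run [:: _] _); commute.
have c3 y : toggle (j, k, n) (run (phase k j) y) = run (phase k j) (toggle (j, k, n) y).
  by rewrite -![toggle _ _]/(run [:: _] _); commute.
have c4 y : run (row n j j) (run (phase k j) y) = run (phase k j) (run (row n j j) y).
  by commute.
rewrite !run_phaseE run_rowE c1 run_row_tetrahedron // -c2 -c3 IH.
by rewrite rev_cons run_rcons c4.
Qed.

(** A scan with third index [n] crosses the moves of lower levels and comes out reversed. The case
    [k = n] is the inductive step of [run_triples_rev]. *)
Lemma run_triples_phase n k x : k <= n ->
  run (triples k) (run (phase n k) x) = run (rev (phase n k)) (run (triples k) x).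
Proof.
elim: k x => [x _|k IH x kn]; first exact: erefl.
have {}IH y := IH y (ltnW kn).
rewrite run_phaseE !run_triplesE run_phase_tetrahedron //.
rewrite rev_cat run_cat -IH.
by commute.
Qed.

Lemma run_triples_rev n x : run (triples n) x = run (rev (triples n)) x.
Proof.
elim: n x => [x|n IH x]; first exact: erefl.
by rewrite run_triplesE run_triples_phase // IH /= rev_cat run_cat.
Qed.

(** Each move being an involution, the reversed word is the inverse of the composite, to which it is
    also equal. *)
Lemma run_triplesK n : involutive (run (triples n)).
Proof. by move=> x; rewrite [LHS]run_triples_rev run_revK // lt3_triples. Qed.

(** * Greedy chains *)

Lemma run_off l x p : (forall t, t \in l -> p \notin wires t) -> run l x p = x p.
Proof.
elim: l x => //= t l IH x h; rewrite IH; last by move=> u ul; rewrite h // inE ul orbT.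
by rewrite toggle_off // h // mem_head.
Qed.

Lemma run_row_off k j i x a b :
  b != k -> (b != j) || (i <= a) -> run (row k j i) x (a, b) = x (a, b).
Proof.
move=> bk bj; apply: run_off => -[[? ?] ?]; rewrite mem_row /= !inE !xpair_eqE; lia.
Qed.

Lemma run_row_off_top k j i x a :
  i <= a -> a != j -> j < k -> run (row k j i) x (a, k) = x (a, k).
Proof.
move=> bk bj jk; apply: run_off => -[[? ?] ?]; rewrite mem_row /= !inE !xpair_eqE; lia.
Qed.

(* A chain of segments is given by its beginnings s, from the top: the r-th one
   is the wire (s_r, j - r), and becomes (s_r, j - r - 1), dropped when empty. *)
Fixpoint chain_rem (j : nat) (s : seq nat) : arr := fun q =>
  if s is a :: s' then (q == (a, j)) + chain_rem j.-1 s' q else 0.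

Fixpoint chain_add (j : nat) (s : seq nat) : arr := fun q =>
  if s is a :: s' then ((a < j.-1) && (q == (a, j.-1))) + chain_add j.-1 s' q else 0.

Lemma chain_rem_off j s i c : j < c -> chain_rem j s (i, c) = 0.
Proof.
by elim: s j => //= a s IH j jc; rewrite IH ?xpair_eqE; lia.
Qed.

Lemma chain_add_off j s i c : j.-1 < c -> chain_add j s (i, c) = 0.
Proof.
by elim: s j => //= a s IH j jc; rewrite IH ?xpair_eqE; lia.
Qed.

(* Nothing is asked about the presence of the chosen segments.  Starting from
   a = j = k puts no condition on the first one but being the largest at level k. *)
Fixpoint greedy (x : arr) (j a : nat) (s : seq nat) : Prop :=
  if s is a' :: s' then
    [/\ a' < a, forall i, a' < i < a -> x (i, j) = 0 & greedy x j.-1 a' s']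
  else forall i, i < a -> x (i, j) = 0.

Lemma greedy_ext x y j a s : (forall i c, c <= j -> x (i, c) = y (i, c)) ->
  greedy x j a s -> greedy y j a s.
Proof.
elim: s j a => [|a' s IH] j a xy /=; first by move=> h i ia; rewrite -xy // h.
case=> aa h g; split=> //; first by move=> i hi; rewrite -xy // h.
by apply: IH g => i c cj; apply: xy; lia.
Qed.

(** The moves of [l] neither read nor write the wires where the arrays may differ. The discrepancy
    is split into [d] and [d'], added on either side, so that no natural subtraction occurs. *)
Lemma run_shift l x x' d d' :
  (forall q, x' q + d q = x q + d' q) ->
  (forall t q, t \in l -> q \in wires t -> d q = 0 /\ d' q = 0) ->
  forall q, run l x' q + d q = run l x q + d' q.
Proof.
elim: l x x' => //= t l IH x x' h h0 q; apply: IH => {q} [q|u q ul]; last first.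
  by apply: h0; rewrite inE ul orbT.
case: (boolP (q \in wires t)) => qt; last by rewrite !toggle_off.
have [-> ->] := h0 t q (mem_head _ _) qt; rewrite !addn0.
apply: toggle_on => // p pt; have := h p.
by have [-> ->] := h0 t p (mem_head _ _) pt; rewrite !addn0.
Qed.

Lemma toggle_ind (P : nat * nat -> Prop) i j k :
  P (i, j) -> P (j, k) -> P (i, k) -> (forall q, q \notin wires (i, j, k) -> P q) ->
  forall q, P q.
Proof.
move=> h1 h2 h3 h4 q; have [] := boolP (q \in wires (i, j, k)); last exact: h4.
by rewrite !inE => /orP[/eqP->//|/orP[/eqP->|/eqP->]].
Qed.

(** For first indices above [a] the moves do nothing, [(i', k)] and [(j, k)] being empty. The move
    at [a] has minimum 0 and pours [(a, k)] into both [(a, j)] and [(j, k)]. As [x'] has one unit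
    less at [(a, k)] and one more at [(a, j)], it ends one unit short at [(j, k)], apart from the
    rest of the chain. *)
Lemma scan_before k j a s i x x' : j < k -> a < i <= j ->
  (forall q, x' q + ((q == (a, k)) + chain_rem j s q)
           = x q + ((q == (a, j)) + chain_add j s q)) ->
  (if s is a' :: _ then a' < a else true) ->
  (forall i', a < i' <= j -> x (i', k) = 0) ->
  exists y y', [/\ forall q, y' q + ((q == (j, k)) + chain_rem j s q) = y q + chain_add j s q,
    forall i', a < i' < j -> y (i', k) = 0,
    forall i' c, (c < j) || (c == j) && (i' < a) -> y (i', c) = x (i', c),
    y (a, k) = 0 &
    run (row k j i) x = run (row k j a) y /\ run (row k j i) x' = run (row k j a) y'].
Proof.
move=> jk; elim: i x x' => [//|i IH] x x' ai h hs z.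
have ij : i < j by lia.
have sa i' : a <= i' -> chain_rem j s (i', j) = 0.
  by case: s hs {h IH} => //= a' s a'a ai'; rewrite chain_rem_off ?xpair_eqE; lia.
have ao i' c : j <= c -> chain_add j s (i', c) = 0.
  by move=> jc; rewrite chain_add_off //; lia.
have ro i' c : j < c -> chain_rem j s (i', c) = 0 by exact: chain_rem_off.
have tw y := toggle_wires y ij jk.
have h1 := h (i, j); have h2 := h (j, k); have h3 := h (i, k).
rewrite sa ?ao ?ro ?xpair_eqE in h1 h2 h3; try lia.
have z1 : x (j, k) = 0 by apply: z; lia.
have [ia|ia] : i = a \/ a < i by lia.
  exists (toggle (i, j, k) x), (toggle (i, j, k) x'); split=> //.
  - apply: (toggle_ind (i := i) (j := j) (k := k)) => [|||q qo].
    + rewrite !tw sa ?ao ?xpair_eqE; lia.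
    + rewrite !tw ro ?ao ?xpair_eqE; lia.
    + rewrite !tw ro ?ao ?xpair_eqE; lia.
    rewrite !toggle_off //; have := h q; move: qo; rewrite /= !inE !negb_or ia.
    by case/and3P=> /negPf-> /negPf-> /negPf->; rewrite !add0n.
  - move=> i' hi; rewrite toggle_off; first by apply: z; lia.
    by rewrite /= !inE !xpair_eqE; lia.
  - by move=> i' c hi; rewrite toggle_off // /= !inE !xpair_eqE; lia.
  - by rewrite -ia tw; lia.
  - by rewrite -ia.
have z2 : x (i, k) = 0 by apply: z; lia.
have [||||y [y' [e1 e2 e3 e4 e5]]] := IH (toggle (i, j, k) x) (toggle (i, j, k) x') => //.
- lia.
- apply: (toggle_ind (i := i) (j := j) (k := k)) => [|||q qo].
  + rewrite !tw sa ?ao ?xpair_eqE; lia.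
  + rewrite !tw ro ?ao ?xpair_eqE; lia.
  + rewrite !tw ro ?ao ?xpair_eqE; lia.
  by rewrite !toggle_off.
- move=> i' hi; have [->|i'i] := eqVneq i' i; first by rewrite tw; lia.
  have [->|i'j] := eqVneq i' j; first by rewrite tw; lia.
  rewrite toggle_off; first by apply: z.
  by rewrite /= !inE !xpair_eqE; lia.
exists y, y'; split=> //.
move=> i' c hi; rewrite e3 // toggle_off // /= !inE !xpair_eqE; lia.
Qed.

(** While [(i', j)] is empty the minimum is 0, and the move pours [(i', k)] equally in both arrays:
    the deficit waits on [(j, k)]. *)
Lemma scan_pending k j lo i x x' (d d' : arr) : j < k -> lo <= i <= j ->
  (forall q, x' q + ((q == (j, k)) + d q) = x q + d' q) ->
  (forall i', d (i', k) = 0 /\ d' (i', k) = 0) ->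
  (forall i', lo <= i' < i -> [/\ x (i', j) = 0, d (i', j) = 0 & d' (i', j) = 0]) ->
  (forall i', i <= i' < j -> x (i', k) = 0) ->
  exists y y', [/\ forall q, y' q + ((q == (j, k)) + d q) = y q + d' q,
    forall i', lo <= i' < j -> y (i', k) = 0,
    forall i' c, (c < j) || (c == j) && (i' < lo) -> y (i', c) = x (i', c) &
    run (row k j i) x = run (row k j lo) y /\ run (row k j i) x' = run (row k j lo) y'].
Proof.
move=> jk; elim: i x x' => [|i IH] x x' loi h dk xj z.
  by exists x, x'; have -> : lo = 0 by lia.
have [li|li] : i.+1 = lo \/ lo <= i by lia.
  by exists x, x'; rewrite -li in z *.
have ij : i < j by lia.
have tw y := toggle_wires y ij jk.
have [x1 d1 d1'] := xj i ltac:(lia).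
have [d2 d2'] := dk i; have [d3 d3'] := dk j.
have h1 := h (i, j); have h2 := h (j, k); have h3 := h (i, k).
rewrite ?xpair_eqE in h1 h2 h3.
have [|||i' hi|i' hi|y [y' [e1 e2 e3 [e4 e5]]]] :=
    IH (toggle (i, j, k) x) (toggle (i, j, k) x') => //.
- lia.
- apply: (toggle_ind (i := i) (j := j) (k := k)) => [|||q qo].
  + rewrite !tw ?xpair_eqE; lia.
  + rewrite !tw ?xpair_eqE; lia.
  + rewrite !tw ?xpair_eqE; lia.
  by rewrite !toggle_off.
- have [e1 e2 e3] := xj i' ltac:(lia); split=> //.
  by rewrite toggle_off // /= !inE !xpair_eqE; lia.
- have [->|i'i] := eqVneq i' i; first by rewrite tw; lia.
  rewrite toggle_off; first by apply: z; lia.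
  by rewrite /= !inE !xpair_eqE; lia.
exists y, y'; split=> //.
move=> i' c hi; rewrite e3 // toggle_off // /= !inE !xpair_eqE; lia.
Qed.

(* The scan of row j moves the unit defect from the wire of the current segment
   of the chain to that of the next one. *)
Lemma scan_row k j a s x x' : j < k -> a <= j ->
  (forall q, x' q + ((q == (a, k)) + chain_rem j s q)
           = x q + ((a < j) && (q == (a, j)) + chain_add j s q)) ->
  (forall i, a < i <= j -> x (i, k) = 0) ->
  greedy x j a s ->
  exists y y', [/\ run (row k j j) x = y, run (row k j j) x' = y',
    forall i c, c < j -> y (i, c) = x (i, c) &
    if s is a' :: s' then
      (forall q, y' q + ((q == (a', k)) + chain_rem j.-1 s' q)
           = y q + ((a' < j.-1) && (q == (a', j.-1)) + chain_add j.-1 s' q)) /\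
      (forall i, a' < i < j -> y (i, k) = 0)
    else forall q, y' q + (q == (j, k)) = y q].
Proof.
move=> jk aj h z g.
have sg : is_true (if s is a' :: _ then a' < a else true).
  by case: s g {h} => //= a' s [].
have [x1 [x1' [h1 z1 o1 [r1 r1']]]] : exists y y',
  [/\ forall q, y' q + ((q == (j, k)) + chain_rem j s q) = y q + chain_add j s q,
    forall i', a <= i' < j -> y (i', k) = 0,
    forall i' c, (c < j) || (c == j) && (i' < a) -> y (i', c) = x (i', c) &
    run (row k j j) x = run (row k j a) y /\ run (row k j j) x' = run (row k j a) y'].
  (* If [a = j], the current segment is a single point: its truncation is empty and the deficit is
     already on [(j, k)]. *)
  have [ej|aj'] := eqVneq a j.
    exists x, x'; rewrite ej; split=> // [q|]; last by lia.
    by have := h q; rewrite ej ltnn andFb add0n.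
  have aj2 : a < j by lia.
  have [|q|y [y' [e1 e2 e3 e4 [e5 e6]]]] := @scan_before k j a s j x x' jk _ _ sg z.
  - by lia.
  - by have := h q; rewrite aj2.
  exists y, y'; split=> // i' hi.
  by have [->|ia] := eqVneq i' a; [exact: e4 | apply: e2; lia].
case: s h g sg h1 => [|a' s] h g sg h1.
  have [|q||i' hi||y [y' [e1 e2 e3 [e4 e5]]]] :=
      @scan_pending k j 0 a x1 x1' (fun=> 0) (fun=> 0) jk.
  - by lia.
  - by have := h1 q.
  - by [].
  - by split=> //; rewrite o1; [apply: g; lia | lia].
  - exact: z1.
  exists y, y'; rewrite r1 r1' e4 e5; split=> // [i c cj|q].
    by rewrite e3 ?o1; lia.
  by have := e1 q; lia.
case: g => /= a'a xj g.
have ro i c : j <= c -> chain_rem j.-1 s (i, c) = 0.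
  by move=> jc; apply: chain_rem_off; lia.
have ao i c : j <= c -> chain_add j.-1 s (i, c) = 0.
  by move=> jc; apply: chain_add_off; lia.
have [|q||i' hi||y [y' [e1 e2 e3 [e4 e5]]]] :=
    @scan_pending k j a'.+1 a x1 x1' (chain_rem j (a' :: s)) (chain_add j (a' :: s)) jk.
- by lia.
- exact: h1.
- by move=> i'; rewrite chain_rem_off ?chain_add_off //; lia.
- split; first by rewrite o1; [apply: xj; lia | lia].
    by rewrite /= ro // xpair_eqE; lia.
  by rewrite chain_add_off; lia.
- exact: z1.
have a'j : a' < j by lia.
have tw y0 := toggle_wires y0 a'j jk.
have n1 : (a' == j) = false by clear -a'j; lia.
have n2 : (j == k) = false by clear -jk; lia.
have n3 : (k == j) = false by clear -jk; lia.
have n4 : (k == j.-1) = false by clear -jk; lia.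
have n5 : (j == j.-1) = false by clear -a'j; lia.
have n6 : (j == a') = false by clear -a'j; lia.
pose n := (xpair_eqE, n1, n2, n3, n4, n5, n6, eqxx, andbF, add0n, addn0).
have roj i : chain_rem j.-1 s (i, j) = 0 by exact: ro.
have rok i : chain_rem j.-1 s (i, k) = 0 by exact: ro (ltnW jk).
have aoj i : chain_add j.-1 s (i, j) = 0 by exact: ao.
have aok i : chain_add j.-1 s (i, k) = 0 by exact: ao (ltnW jk).
(* Both arguments of the minimum are one lower for [y'], hence so is the minimum: after the move at
   [a'], the wires [(a', j)] and [(j, k)] agree and the deficit sits on [(a', k)]. *)
have f1 : y' (a', j) + 1 = y (a', j) by have := e1 (a', j); rewrite /= roj aoj !n.
have f2 : y' (j, k) + 1 = y (j, k) by have := e1 (j, k); rewrite /= rok aok !n.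
have f3 : y' (a', k) = y (a', k) by have := e1 (a', k); rewrite /= rok aok !n.
exists (run (row k j a') (toggle (a', j, k) y)), (run (row k j a') (toggle (a', j, k) y')).
rewrite r1 r1' e4 e5 !run_rowE; split=> // [i c cj|].
  rewrite run_row_off; try lia.
  rewrite toggle_off; last by rewrite /= !inE !xpair_eqE; lia.
  by rewrite e3 ?o1; lia.
split=> [|i hi]; last first.
  rewrite run_row_off_top; try lia.
  rewrite toggle_off; last by rewrite /= !inE !xpair_eqE; lia.
  by apply: e2; lia.
apply: run_shift => [|[[u v] w] [q1 q2]].
  apply: (toggle_ind (i := a') (j := j) (k := k)) => [|||q qo].
  - by rewrite !tw roj aoj !n f3 -f1 -f2; clear; lia.
  - by rewrite !tw rok aok !n f3 -f1 -f2; clear; lia.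
  - by rewrite !tw rok aok !n -f1 -f2; clear; lia.
  rewrite !toggle_off //; have := e1 q; move: qo; rewrite /= !inE !negb_or.
  by case/and3P=> /negPf-> /negPf-> /negPf->; rewrite !add0n.
rewrite mem_row => /and3P[ua /eqP-> /eqP->]; rewrite /= !inE !xpair_eqE => hq.
have [q2j|q2j] : q2 = j \/ q2 = k by lia.
  by rewrite ro ?ao; lia.
by rewrite ro ?ao; lia.
Qed.

(** Once the chain is exhausted, the deficit rests on the wire joining the current row to [k], which
    the remaining rows do not touch. This wire is the head of the chain. *)
Lemma run_phase_defect k j s a x x' : j < k -> a <= j ->
  (forall q, x' q + ((q == (a, k)) + chain_rem j s q)
           = x q + ((a < j) && (q == (a, j)) + chain_add j s q)) ->
  (forall i, a < i <= j -> x (i, k) = 0) ->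
  greedy x j a s ->
  forall q, run (phase k j.+1) x q = run (phase k j.+1) x' q + (q == (j - size s, k)).
Proof.
elim: s j a x x' => [|a' s IH] j a x x' jk aj h z g q;
    have [y [y' [ey ey' o P]]] := scan_row jk aj h z g; rewrite !run_phaseE ey ey'.
  rewrite subn0 -[LHS]addn0; symmetry.
  apply: (@run_shift _ _ _ (fun q => (q == (j, k) : nat)) (fun=> 0)) => [q'|].
    by rewrite P addn0.
  move=> [[u v] w] [q1 q2]; rewrite mem_phase /= !inE !xpair_eqE => *; lia.
case: P g => h' z' [/= a'a _ g].
have j0 : 0 < j by lia.
have -> : j - (size s).+1 = j.-1 - size s by lia.
have {1 2}-> : j = j.-1.+1 by lia.
apply: (IH _ a') => //; try lia.
  by move=> i hi; apply: z'; lia.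
by apply: greedy_ext g => i c cj; rewrite o; lia.
Qed.

Lemma run_phase_greedy k a s x x' : a < k ->
  (forall q, x' q + chain_rem k (a :: s) q = x q + chain_add k (a :: s) q) ->
  (forall i, a < i < k -> x (i, k) = 0) ->
  greedy x k.-1 a s ->
  forall q, run (phase k k) x q = run (phase k k) x' q + (q == (k.-1 - size s, k)).
Proof.
case: k => [//|k] ak h z g; exact: (@run_phase_defect k.+1 k s a).
Qed.

(** * From one level to the whole composite *)

Lemma toggle_id i j k x : i < j -> j < k -> x (i, k) = 0 -> x (j, k) = 0 ->
  toggle (i, j, k) x = x.
Proof.
move=> ij jk xik xjk; apply/funext; have tw := toggle_wires x ij jk.
apply: (toggle_ind (i := i) (j := j) (k := k)) => [|||q qo]; last by rewrite toggle_off.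
- by rewrite tw xik xjk minn0 addn0 subn0.
- by rewrite tw xik xjk minn0.
- by rewrite tw xik xjk minn0.
Qed.

Lemma run_phase_id k x : (forall i, i < k -> x (i, k) = 0) -> run (phase k k) x = x.
Proof.
move=> x0; suff h l : {subset l <= phase k k} -> run l x = x by exact: h.
elim: l => //= -[[a b] c] l IH h.
have := h _ (mem_head _ _); rewrite mem_phase => /and3P[ab bk /eqP ->].
by rewrite toggle_id ?x0 ?IH //; [move=> t tl; rewrite h // inE tl orbT | lia].
Qed.

Lemma run_triples0 n x : (forall i c, i < c -> c < n -> x (i, c) = 0) ->
  run (triples n) x = x.
Proof.
elim: n => [//|n IH] x0; rewrite run_triplesE run_phase_id => [|i ni]; last by apply: x0.
by apply: IH => i c ic cn; apply: x0 => //; exact: ltnW.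
Qed.

(** The recursion $m^t = m_1 + (m^\#)^t$ for the composite: the levels above [k] are empty, level
    [k] leaves one unit on the head, and the lower levels do not meet the wires ending at [k]. *)
Lemma run_triples_greedy n k a s x x' : k < n ->
  (forall i c, i < c -> k < c < n -> x (i, c) = 0) ->
  (forall q, x' q + chain_rem k (a :: s) q = x q + chain_add k (a :: s) q) ->
  greedy x k k (a :: s) ->
  forall q, run (triples n) x q = run (triples n) x' q + (q == (k.-1 - size s, k)).
Proof.
move=> + + h g; elim: n => [//|n IH] kn x0 q; rewrite !run_triplesE.
have [ek|nk] := eqVneq n k.
  rewrite {}ek {IH} in kn x0 *.
  have [ak z g'] := g; rewrite -[LHS]addn0; symmetry.
  apply: (@run_shift _ _ _ (fun q => (q == (k.-1 - size s, k) : nat)) (fun=> 0)) => [q'|].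
    by rewrite addn0 -(@run_phase_greedy k a s x x').
  by move=> [[u v] w] [q1 q2]; rewrite mem_triples /= !inE !xpair_eqE => *; lia.
have x'0 i : i < n -> x' (i, n) = 0.
  move=> ni; have := h (i, n).
  by rewrite chain_rem_off ?chain_add_off ?x0; lia.
rewrite !run_phase_id => [||i ni]; [|exact: x'0|by apply: x0; lia].
by apply: IH => [|i c ic cn]; [lia | apply: x0; lia].
Qed.

(** The entries that [x] may have beyond those of [x'] are wires of the chain itself, and none falls
    in the gap required to be empty at its level. This transfers greediness from [m] to
    [CT_op s m]. *)
Lemma greedy_le x x' k a s : a <= k ->
  (forall i c, c <= k -> x (i, c) <= x' (i, c) + chain_rem k s (i, c)) ->
  greedy x' k a s -> greedy x k a s.
Proof.
elim: s k a => [|a' s IH] k a ak h /=.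
  by move=> z i ia; have := h i k (leqnn k); rewrite z //=; lia.
case=> aa z g; split=> // [i hi|].
  by have /= := h i k (leqnn k); rewrite z // chain_rem_off ?xpair_eqE; lia.
apply: IH g => [|i c ck]; first by lia.
by have /= := h i c; rewrite xpair_eqE; lia.
Qed.

(** Segments whose second indices run from [b] to [b + r], with strictly increasing beginnings, the
    last being [a]: the shape of the [Theta_i] in [m]. *)
Fixpoint ladder (x : arr) (b r a : nat) : Prop :=
  0 < x (a, b + r) /\ if r is r'.+1 then exists2 a', a' < a & ladder x b r' a' else True.

(** By induction the greedy chain begins, at each level, at or after the rung of that level. The
    next rung is thus available, and the chain cannot stop before the ladder does. *)
Lemma greedy_ladder x b r a0 j a s : 0 < b -> b + r = j.+1 -> a0 <= a ->
  ladder x b r a0 -> greedy x j a s -> r <= size s.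
Proof.
move=> b0; elim: r a0 j a s => [//|r IH] a0 j a s bj aa0 [_ [a1 a10 lad]].
have xa1 : 0 < x (a1, j) by case: r lad bj {IH} => [|r] [] + _ bj; congr (0 < x (_, _)); lia.
case: s => [z|a2 s [aa z g]] /=; first by have := z a1; lia.
apply: (IH a1 j.-1 a2) => //; first by lia.
by rewrite leqNgt; apply/negP => a21; have := z a1; lia.
Qed.

Fixpoint chain_wires (j : nat) (s : seq nat) : seq (nat * nat) :=
  if s is a :: s' then (a, j) :: chain_wires j.-1 s' else [::].

Lemma chain_remE j s q : chain_rem j s q = count (pred1 q) (chain_wires j s).
Proof. by elim: s j => //= a s IH j; rewrite IH eq_sym. Qed.

Lemma chain_addE j s q : chain_add j s q =
  count (fun p => (p.1 < p.2)%N && (p == q)) [seq (p.1, p.2.-1) | p <- chain_wires j s].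
Proof. by elim: s j => //= a s IH j; rewrite IH /= [q == _]eq_sym. Qed.

Lemma rev_iotaS a d : rev (iota a d.+1) = (a + d) :: rev (iota a d).
Proof. by rewrite -addn1 iotaD rev_cat. Qed.

Lemma greedy_singles x a d t : greedy x a a t ->
  greedy x (a + d) (a + d) (rev (iota a d) ++ t).
Proof.
move=> g; elim: d => [|d IH]; first by rewrite addn0.
rewrite rev_iotaS addnS; split=> //; first by move=> i; lia.
Qed.

Lemma chain_rem_singles a d t q : chain_rem (a + d) (rev (iota a d) ++ t) q =
  count (fun i => (i, i.+1) == q) (iota a d) + chain_rem a t q.
Proof.
elim: d => [|d IH]; first by rewrite addn0.
rewrite rev_iotaS addnS [LHS]/= IH -[d.+1]addn1 iotaD count_cat /= eq_sym; lia.
Qed.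

Lemma chain_add_singles a d t q :
  chain_add (a + d) (rev (iota a d) ++ t) q = chain_add a t q.
Proof.
elim: d => [|d IH]; first by rewrite addn0.
by rewrite rev_iotaS addnS /= IH ltnn.
Qed.

(** * Multisegments as arrays *)

Import Order.TTheory GRing.Theory Num.Theory.
Local Open Scope ring_scope.
Local Open Scope mset_scope.

Section Wires.
Variables (R : realType) (c o : R).
Implicit Types (D s : seg c) (m : mult c) (p q : nat * nat).

Definition ends p : R * R := (o + p.1%:R, o + p.2%:R - 1).

(* Locked, for otherwise simplification exposes the truncations in its
   projections; meaningful only for framed segments, truncn being 0 below 0. *)
Definition wire D : nat * nat :=
  locked (Num.truncn (sb D - o), Num.truncn (se D + 1 - o)).

(** Testing the beginning is enough: the end differs from it by a natural number. *)
Definition framed D : bool := sb D - o \is a Num.nat.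

Definition mulw m : arr := fun q => count (fun D => wire D == q) m.

Lemma wire_ends D p : seg_ends D = ends p -> wire D = p.
Proof.
move=> e; rewrite /wire -lock /sb /se e /= addrNK ![o + _]addrC !addrK !natrK.
by case: p {e}.
Qed.

Lemma seg_endsE D : framed D ->
  seg_ends D = ends (wire D) /\ ((wire D).1 < (wire D).2)%N.
Proof.
move=> fD; have /and3P[ib ie be] := segP D; have fD' := fD; move: fD'.
rewrite /framed -/(sb D) -/(se D) in ib ie be *.
move=> /natrP[i ei].
have /natrP[d ed] : se D - sb D \is a Num.nat.
  rewrite natrEint subr_ge0 be andbT.
  have -> : se D - sb D = se D - c - (sb D - c) by lra.
  by rewrite rpredB.
suff e : seg_ends D = ends (i, (i + d).+1) by rewrite (wire_ends e); split=> //=; lia.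
rewrite [seg_ends D]surjective_pairing -/(sb D) -/(se D) /ends /=.
congr pair; first by rewrite -ei; lra.
rewrite -natr1 natrD -ei -ed; lra.
Qed.

Lemma sbE D : framed D -> sb D = o + (wire D).1%:R.
Proof. by move=> /seg_endsE[e _]; rewrite /sb e. Qed.

Lemma seE D : framed D -> se D = o + (wire D).2%:R - 1.
Proof. by move=> /seg_endsE[e _]; rewrite /se e. Qed.

Lemma wire_lt D : framed D -> ((wire D).1 < (wire D).2)%N.
Proof. by case/seg_endsE. Qed.

Lemma wire_inj D D' : framed D -> framed D' -> wire D = wire D' -> D = D'.
Proof.
by move=> fD fD' e; apply: seg_inj; rewrite ?sbE ?seE // e.
Qed.

Lemma seg_gtE D D' : framed D -> framed D' ->
  seg_gt D D' = ((wire D').1 < (wire D).1)%N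
    || ((wire D).1 == (wire D').1) && ((wire D).2 < (wire D').2)%N.
Proof.
move=> fD fD'; rewrite /seg_gt !sbE // !seE //.
by rewrite ltrD2l ltr_nat (inj_eq (addrI o)) eqr_nat ltrD2r ltrD2l ltr_nat.
Qed.

Lemma seg_geE D D' : framed D -> framed D' ->
  seg_ge D D' = ((wire D').1 < (wire D).1)%N
    || ((wire D).1 == (wire D').1) && ((wire D).2 <= (wire D').2)%N.
Proof.
move=> fD fD'; rewrite /seg_ge seg_gtE //.
have -> : (D == D') = (wire D == wire D').
  by apply/eqP/eqP => [->//|]; exact: wire_inj.
by case: (wire D) (wire D') => [a b] [a' b']; rewrite xpair_eqE /=; lia.
Qed.

Lemma se_leE D D' : framed D -> framed D' ->
  (se D <= se D') = ((wire D).2 <= (wire D').2)%N.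
Proof. by move=> fD fD'; rewrite !seE // lerD2r lerD2l ler_nat. Qed.

Lemma se_predE D D' : framed D -> framed D' ->
  (se D' == se D - 1) = ((wire D').2.+1 == (wire D).2).
Proof.
move=> fD fD'; rewrite !seE // (inj_eq (addIr _)) -[RHS](eqr_nat R) -natr1.
by apply/eqP/eqP; lra.
Qed.

Lemma mulwD m m' q : mulw (m `+` m') q = (mulw m q + mulw m' q)%N.
Proof.
rewrite /mulw -count_cat; apply/permP; apply/allP => D _ /=.
by rewrite count_cat !count_mem_mset msetE2.
Qed.

Lemma mulw_seq (l : seq (seg c)) q :
  mulw (seq_mset l) q = count (fun D => wire D == q) l.
Proof. exact: (permP (perm_eq_seq_mset l)). Qed.

Lemma mulw1 s q : mulw [mset s] q = (q == wire s).
Proof. by rewrite /mulw enum_msetn /= addn0 eq_sym. Qed.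

Lemma mulw0 q : mulw mset0 q = 0%N.
Proof. by rewrite /mulw enum_mset0. Qed.

Lemma mulw_gt0 m D : D \in m -> (0 < mulw m (wire D))%N.
Proof. by move=> Dm; rewrite /mulw -has_count; apply/hasP; exists D. Qed.

Lemma mulw_gt0P m q : (0 < mulw m q)%N -> exists2 D, D \in m & wire D = q.
Proof. by rewrite /mulw -has_count => /hasP[D Dm /eqP e]; exists D. Qed.

Lemma mulw_eq0 m q : (forall D, D \in m -> wire D <> q) -> mulw m q = 0%N.
Proof.
by move=> h; apply/eqP; rewrite -leqn0 leqNgt; apply/negP => /mulw_gt0P[D /h].
Qed.

Lemma mulw_inj m m' : (forall D, D \in m -> framed D) -> (forall D, D \in m' -> framed D) ->
  mulw m =1 mulw m' -> m = m'.
Proof.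
have h m0 D : (forall D, D \in m0 -> framed D) -> framed D -> m0 D = mulw m0 (wire D).
  move=> fm fD; rewrite -count_mem_mset; apply: eq_in_count => D' D'm /=.
  by apply/eqP/eqP => [->//|]; apply: wire_inj => //; exact: fm.
move=> fm fm' e; apply/msetP => D; case: (boolP (framed D)) => fD; first by rewrite !h ?e.
have z m0 : (forall D, D \in m0 -> framed D) -> m0 D = 0%N.
  by move=> fm0; apply/eqP; rewrite mset_eq0; apply: contra fD => /fm0.
by rewrite !z.
Qed.

Hypothesis oc : o - c \is a Num.int.

Lemma is_seg_ends p : is_seg c (ends p) = (p.1 < p.2)%N.
Proof.
rewrite /is_seg /ends /=.
have -> : o + p.1%:R - c = o - c + p.1%:R by lra.
have -> : o + p.2%:R - 1 - c = o - c + p.2%:R - 1 by lra.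
have -> : o - c + p.1%:R \is a Num.int by rewrite rpredD ?natr_int.
have -> /= : o - c + p.2%:R - 1 \is a Num.int by rewrite rpredB ?int_num1 // rpredD ?natr_int.
by rewrite -addrA lerD2l lerBrDr natr1 ler_nat.
Qed.

Lemma mulw_segs (l : seq (nat * nat)) q :
  mulw (segs c (map ends l)) q = count (fun p => (p.1 < p.2)%N && (p == q)) l.
Proof.
rewrite mulw_seq; elim: l => //= p l IH.
case: insubP => [D pD e|/negPf pD] /=; rewrite is_seg_ends in pD; rewrite pD //=.
by rewrite IH (wire_ends e).
Qed.

Lemma framed_segs (l : seq (nat * nat)) D :
  D \in segs c (map ends l) -> framed D /\ wire D \in l.
Proof.
rewrite -[_ \in _]/(D \in enum_mset _) (perm_mem (perm_eq_seq_mset _)) mem_pmap_sub.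
case/mapP=> p pl e; rewrite (wire_ends e); split=> //.
by rewrite /framed /sb e /= [o + _]addrC addrK natr_nat.
Qed.

(** * The algorithm read on wires *)

Definition bounded n m := forall D, D \in m -> framed D /\ ((wire D).2 < n)%N.

Lemma bounded_framed n m D : bounded n m -> D \in m -> framed D.
Proof. by move=> bm /bm[]. Qed.

Lemma iterates_path (T : eqType) (f : T -> option T) n x y u :
  iterates f n x = y :: u -> x = Some y /\ path (fun a b => f a == Some b) y u.
Proof.
elim: n x y u => [|n IH] [z|] y u //= [<- e]; split=> //.
by case: u e => //= y' u /IH[-> ->]; rewrite eqxx.
Qed.

Lemma mw_first_wire n m D : bounded n m -> mw_first m = Some D ->
  D \in m /\ forall D', D' \in m -> ((wire D').2 <= (wire D).2)%N /\
    ((wire D').2 = (wire D).2 -> (wire D').1 <= (wire D).1)%N.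
Proof.
move=> bm; rewrite /mw_first => E.
have := largestP [seq D <- m | all (fun D' => se D' <= se D) m].
rewrite E mem_filter => -[/andP[/allP top Dm] max]; split=> // D' D'm.
have [fD fD'] := (bounded_framed bm Dm, bounded_framed bm D'm).
split=> [|e]; first by rewrite -se_leE //; exact: top.
have /max : D' \in [seq D <- m | all (fun D' => se D' <= se D) m].
  rewrite mem_filter D'm andbT; apply/allP => D2 D2m.
  by have fD2 := bounded_framed bm D2m; rewrite se_leE // e -se_leE //; exact: top.
by rewrite seg_geE // e; lia.
Qed.

(** Among segments with the same beginning the shorter is the larger, and [D'] ends one step before
    [D]; so [seg_ge D D'] forces a strictly smaller beginning. *)
Lemma mw_next_mem n m D D' : bounded n m -> D \in m -> D' \in m ->
  (D' \in [seq D' <- m | (se D' == se D - 1) && seg_ge D D']) =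
  ((wire D').2.+1 == (wire D).2) && ((wire D').1 < (wire D).1)%N.
Proof.
move=> bm Dm D'm; have [fD fD'] := (bounded_framed bm Dm, bounded_framed bm D'm).
by rewrite mem_filter D'm andbT se_predE // seg_geE //; lia.
Qed.

Lemma mw_next_Some n m D D1 : bounded n m -> D \in m -> mw_next m D = Some D1 ->
  [/\ D1 \in m, (wire D1).2.+1 = (wire D).2, ((wire D1).1 < (wire D).1)%N &
    forall D', D' \in m -> (wire D').2.+1 = (wire D).2 ->
      ((wire D').1 < (wire D).1 -> (wire D').1 <= (wire D1).1)%N].
Proof.
move=> bm Dm; rewrite /mw_next => E.
have := largestP [seq D' <- m | (se D' == se D - 1) && seg_ge D D'].
rewrite E => -[D1f max].
have D1m : D1 \in m by move: D1f; rewrite mem_filter => /andP[].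
move: D1f; rewrite (mw_next_mem bm) // => /andP[/eqP e1 lt1]; split=> // D' D'm e lt.
have /max : D' \in [seq D' <- m | (se D' == se D - 1) && seg_ge D D'].
  by rewrite (mw_next_mem bm) // e eqxx.
by rewrite seg_geE ?(bounded_framed bm) //; lia.
Qed.

Lemma mw_next_None n m D : bounded n m -> D \in m -> mw_next m D = None ->
  forall D', D' \in m -> (wire D').2.+1 = (wire D).2 -> ((wire D).1 <= (wire D').1)%N.
Proof.
move=> bm Dm; rewrite /mw_next => E.
have := largestP [seq D' <- m | (se D' == se D - 1) && seg_ge D D'].
rewrite E => nil D' D'm e; have := mw_next_mem bm Dm D'm.
by rewrite nil in_nil e eqxx /=; lia.
Qed.

Lemma mw_chain_wires n m D u : bounded n m -> D \in m ->
  path (fun a b => mw_next m a == Some b) D u -> mw_next m (last D u) = None ->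
  [/\ map wire (D :: u) = chain_wires (wire D).2 [seq (wire D').1 | D' <- D :: u],
    ((wire (last D u)).2 + size u = (wire D).2)%N, {subset D :: u <= m} &
    greedy (mulw m) (wire D).2.-1 (wire D).1 [seq (wire D').1 | D' <- u]].
Proof.
move=> bm; elim: u D => [|D1 u IH] D Dm /=.
  move=> _ e; split; [by case: (wire D)|by rewrite addn0|by move=> D'; rewrite inE => /eqP->|].
  move=> i iD; apply: mulw_eq0 => D' D'm e'.
  have D0 := wire_lt (bounded_framed bm Dm).
  by have := mw_next_None bm Dm e D'm; rewrite e' /= prednK => [/(_ erefl)|]; lia.
case/andP=> /eqP /(mw_next_Some bm Dm)[D1m e1 lt1 max] pu lst.
have [h1 h2 h3 h4] := IH D1 D1m pu lst; move: h1 => /= h1; split.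
- by rewrite [in LHS](surjective_pairing (wire D)) -e1 /= -h1.
- by rewrite addnS h2 e1.
- by move=> D'; rewrite inE => /orP[/eqP->//|/h3].
- rewrite -e1 /=; split=> // i hi; apply: mulw_eq0 => D' D'm e'.
  by have := max D' D'm; rewrite e' /= e1 => /(_ erefl); lia.
Qed.

Lemma mw_sharp_eq m D u : mw_chain m = D :: u -> forall q,
  (mulw (mw_sharp m) q + count (fun D => wire D == q) (D :: u) =
   mulw m q + mulw (segs c [seq (sb D, (se D - 1)%R) | D <- D :: u]) q)%N.
Proof.
move=> E q; have [_ uq sub] := mw_chainP E.
have le_m : seq_mset (D :: u) `<=` m.
  apply/msubsetP => D'; rewrite mset_seqE count_uniq_mem //.
  by case: (boolP (D' \in _)) => // /sub; rewrite -mset_gt0.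
rewrite /mw_sharp E mulwD -{2}(msetBDK le_m) mulwD mulw_seq; lia.
Qed.

Lemma ends_last D D' : framed D -> framed D' ->
  (se D, se D') = ends ((wire D).2.-1, (wire D').2).
Proof.
move=> fD fD'; rewrite /ends /= !seE //; congr pair.
by rewrite -subn1 natrB ?addrA //; have := wire_lt fD; lia.
Qed.

Lemma ends_pred D : framed D -> (sb D, se D - 1) = ends ((wire D).1, (wire D).2.-1).
Proof.
move=> fD; rewrite /ends /= sbE // seE //; congr (_, _ - 1).
by rewrite -subn1 natrB ?addrA //; have := wire_lt fD; lia.
Qed.

(** Packages one step of the algorithm into the hypotheses of [run_triples_greedy]; the presence of
    the wire [(a, k)] and the bound on [size t] also locate the head in [ct_chain_short]. *)
Lemma mw_step n m : bounded n m -> m != mset0 -> exists k a t,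
  [/\ [/\ (k < n)%N, (0 < mulw m (a, k))%N, (size t < k)%N &
          forall i j, (k < j)%N -> mulw m (i, j) = 0%N],
      forall q, (mulw (mw_sharp m) q + chain_rem k (a :: t) q =
                 mulw m q + chain_add k (a :: t) q)%N,
      greedy (mulw m) k k (a :: t),
      forall q, mulw (mw_head m) q = (q == (k.-1 - size t, k))%N :> nat &
      bounded n (mw_head m) /\ bounded n (mw_sharp m)].
Proof.
move=> bm m0; case E: (mw_chain m) => [|D u].
  by rewrite (mw_chain_nil E) eqxx in m0.
have [first pu] := iterates_path E; have lst := mw_chain_stop E.
have [Dm top] := mw_first_wire bm first.
have [h1 h2 h3 h4] := mw_chain_wires bm Dm pu lst.
have fm D' : D' \in m -> framed D' := @bounded_framed n m D' bm.
have [fD Dn] := bm D Dm; have D0 := wire_lt fD.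
have lm : last D u \in m by apply: h3; exact: mem_last.
have fl := fm _ lm; have l0 := wire_lt fl.
have eh : mw_head m = segs c (map ends [:: ((wire (last D u)).2.-1, (wire D).2)]).
  by rewrite /mw_head E ends_last.
have es : [seq (sb D, se D - 1) | D <- D :: u] =
    map ends [seq (p.1, p.2.-1) | p <- map wire (D :: u)].
  by rewrite -!map_comp; apply/eq_in_map => D' /h3 /fm fD'; exact: ends_pred.
exists (wire D).2, (wire D).1, [seq (wire D').1 | D' <- u].
rewrite size_map; split.
- split=> //; [by have := mulw_gt0 Dm; rewrite {1}[wire D]surjective_pairing|lia|].
  move=> i j kj; apply: mulw_eq0 => D' /top[le _] e; move: le kj.
  by rewrite e /=; lia.
- move=> q; have := mw_sharp_eq E q.
  rewrite es mulw_segs h1 -chain_addE => <-; congr (_ + _)%N.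
  by rewrite chain_remE -/(map _ (D :: u)) -h1 count_map.
- split=> // i hi; apply: mulw_eq0 => D' /top[_ le] e; move: le.
  by rewrite e /= => /(_ erefl); lia.
- move=> q; rewrite eh mulw_segs /= addn0 eq_sym -h2.
  have -> : ((wire (last D u)).2.-1 < (wire (last D u)).2 + size u)%N by lia.
  by congr (nat_of_bool (_ == (_, _))); lia.
- split=> D'.
    rewrite eh => /framed_segs[fD']; rewrite inE => /eqP eD'; split=> //.
    by rewrite eD'.
  rewrite /mw_sharp in_msetD => /orP[D'm|].
    apply: bm; move: D'm; rewrite in_msetB -mset_gt0; exact: leq_ltn_trans.
  rewrite E es => /framed_segs[fD']; split=> //; move: b.
  case/mapP=> p /mapP[D2 /h3 /bm[_ D2n] ->] -> /=.
  by apply: leq_ltn_trans D2n; exact: leq_pred.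
Qed.

(** Induction on the total length, matching [mw_dualE] with [run_triples_greedy]. *)
Lemma mw_dual_run n m : bounded n m ->
  bounded n (mw_dual m) /\ mulw (mw_dual m) =1 run (triples n) (mulw m).
Proof.
elim: {m}_.+1 {-2}m (ltnSn (mult_length m)) => // l IH m lm bm.
have [->|m0] := eqVneq m mset0.
  rewrite mw_dual0; split=> [D|q]; first by rewrite in_mset0.
  by rewrite run_triples0 // => i j _ _; exact: mulw0.
have [k [a [t [[kn _ _ top] h g head [bh bs]]]]] := mw_step bm m0.
have [|bd rd] := IH (mw_sharp m) _ bs.
  by have := mult_length_sharp m0; lia.
rewrite mw_dualE //; split=> [D|q].
  by rewrite in_msetD => /orP[/bh|/bd].
rewrite mulwD head rd addnC; symmetry; apply: run_triples_greedy => //.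
by move=> i j _ /andP[kj _]; exact: top.
Qed.

Lemma mw_dualK n m : bounded n m -> mw_dual (mw_dual m) = m.
Proof.
move=> bm; have [bd rd] := mw_dual_run bm; have [bdd rdd] := mw_dual_run bd.
apply: mulw_inj => [D /bdd[]//|D /bm[]//|q].
by rewrite rdd (funext rd) run_triplesK.
Qed.

(** * The operator CT_s *)

Lemma ct_first_wire n m s : bounded n m -> framed s ->
  if ct_first s m is Some D then
    [/\ D \in m, (wire D).2 = (wire s).1 &
      forall D', D' \in m -> (wire D').2 = (wire s).1 -> ((wire D).1 <= (wire D').1)%N]
  else forall D', D' \in m -> (wire D').2 <> (wire s).1.
Proof.
move=> bm fs.
have e D : D \in m -> (D \in [seq D <- m | se D == sb s - 1]) = ((wire D).2 == (wire s).1).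
  move=> Dm; have fD := bounded_framed bm Dm.
  by rewrite mem_filter Dm andbT seE // sbE // (inj_eq (addIr _)) (inj_eq (addrI _)) eqr_nat.
have := smallestP [seq D <- m | se D == sb s - 1]; rewrite -/(ct_first s m).
case: (ct_first s m) => [D [D1 min]|nil D' D'm e']; last first.
  by have := e D' D'm; rewrite nil in_nil e' eqxx.
have Dm : D \in m by move: D1; rewrite mem_filter => /andP[].
move: D1; rewrite e // => /eqP eD; split=> // D' D'm eD'.
have /min : D' \in [seq D <- m | se D == sb s - 1] by rewrite e ?eD'.
by rewrite seg_geE ?(bounded_framed bm) // => hD; lia.
Qed.

Lemma ct_next_wire n m D : bounded n m -> D \in m ->
  if ct_next m D is Some D1 then
    [/\ D1 \in m, (wire D1).2 = (wire D).2.+1, ((wire D).1 < (wire D1).1)%N &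
      forall D', D' \in m -> (wire D').2 = (wire D).2.+1 ->
        ((wire D).1 < (wire D').1 -> (wire D1).1 <= (wire D').1)%N]
  else forall D', D' \in m -> (wire D').2 = (wire D).2.+1 -> ((wire D').1 <= (wire D).1)%N.
Proof.
move=> bm Dm; have fD := bounded_framed bm Dm.
have e D' : D' \in m -> (D' \in [seq D' <- m | (se D' == se D + 1) && seg_gt D' D]) =
    ((wire D').2 == (wire D).2.+1) && ((wire D).1 < (wire D').1)%N.
  move=> D'm; have fD' := bounded_framed bm D'm.
  rewrite mem_filter D'm andbT -subr_eq eq_sym se_predE // seg_gtE //.
  by apply/idP/idP; lia.
have := smallestP [seq D' <- m | (se D' == se D + 1) && seg_gt D' D].
rewrite -/(ct_next m D); case: (ct_next m D) => [D1 [D1f min]|nil D' D'm e'].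
  have D1m : D1 \in m by move: D1f; rewrite mem_filter => /andP[].
  move: D1f; rewrite e // => /andP[/eqP e1 lt1]; split=> // D' D'm e' lt'.
  have /min : D' \in [seq D' <- m | (se D' == se D + 1) && seg_gt D' D].
    by rewrite e // e' eqxx.
  by rewrite seg_geE ?(bounded_framed bm) // => hD; lia.
by have := e D' D'm; rewrite nil in_nil e' eqxx /=; lia.
Qed.

(** One family of empty gaps has two readings: upwards, each [Theta_{i+1}] is the smallest choice
    after [Theta_i]; downwards, the [Theta_i^+] form a greedy chain. The accumulators [t] and [r]
    hold the chain below [D] and the height of the ladder. *)
Lemma ct_path_wires n m b r D u t : bounded n m -> D \in m ->
  path (fun D1 D2 => ct_next m D1 == Some D2) D u -> ct_next m (last D u) = None ->
  greedy (mulw m) (wire D).2 (wire D).1 t -> ladder (mulw m) b r (wire D).1 ->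
  (wire D).2 = (b + r)%N ->
  let k := (wire (last D u)).2.+1 in let t' := rev [seq (wire D').1 | D' <- D :: u] ++ t in
  [/\ k = (b + r + size u).+1,
    ladder (mulw m) b (r + size u) (wire (last D u)).1,
    greedy (mulw m) k k t',
    forall q, chain_rem k t' q = (chain_rem (wire D).2 t q
      + count (fun D' => ((wire D').1, (wire D').2.+1) == q) (D :: u))%N /\
      chain_add k t' q = (chain_add (wire D).2 t q
      + count (fun D' => wire D' == q) (D :: u))%N &
    [/\ uniq (D :: u), {subset D :: u <= m} &
      forall D', D' \in D :: u -> ((wire D).2 <= (wire D').2)%N]].
Proof.
move=> bm; elim: u D r t => [|D1 u IH] D r t Dm pu lst g lad eD /=.
  have D0 := wire_lt (bounded_framed bm Dm).
  rewrite !addn0; split=> //.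
  - by rewrite eD.
  - split=> [||//]; first by lia.
    move=> i hi; apply: mulw_eq0 => D' D'm e'.
    have := ct_next_wire bm Dm; rewrite lst => /(_ D' D'm); rewrite e' => /(_ erefl) /=.
    by lia.
  - move=> q; rewrite D0 /= ![q == _]eq_sym -surjective_pairing !addn0.
    by split; rewrite addnC.
  - by split=> // D'; rewrite inE => /eqP->.
case/andP: pu => /eqP e1 pu; have := ct_next_wire bm Dm; rewrite e1.
case=> D1m eD1 lt1 min.
have [|||h1 h2 h3 h4 [h5 h6 h7]] := IH D1 r.+1 ((wire D).1 :: t) D1m pu lst.
- rewrite eD1; split=> // i hi; apply: mulw_eq0 => D' D'm e'.
  by have := min D' D'm; rewrite e' => /(_ erefl) /=; lia.
- split; last by exists (wire D).1.
  have := mulw_gt0 D1m; rewrite {1}[wire D1]surjective_pairing eD1 eD.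
  by rewrite addnS.
- by rewrite eD1 eD addnS.
rewrite rev_cons cat_rcons; split=> //.
- by rewrite h1; lia.
- by rewrite addnS -addSn.
- move=> q; have [-> ->] := h4 q; rewrite /= !eD1 /= (wire_lt (bounded_framed bm Dm)) /=.
  rewrite ![q == _]eq_sym -surjective_pairing.
  by split; rewrite -addnA addnCA.
- split=> [|D'|D'].
  + rewrite /= in h5 *; rewrite h5 andbT; apply/negP => /h7.
    by rewrite eD1 ltnn.
  + by rewrite inE => /orP[/eqP->//|/h6].
  + rewrite inE => /orP[/eqP->//|/h7]; rewrite eD1; exact: ltnW.
Qed.

Lemma ct_chain_wires n m s : bounded n m -> framed s -> exists t,
  let k := ((wire s).1 + size t)%N in
  [/\ greedy (mulw m) k k t,
    forall q,
      chain_rem k t q =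
        count (fun D => ((wire D).1, (wire D).2.+1) == q) (ct_chain s m) /\
      chain_add k t q = count (fun D => wire D == q) (ct_chain s m),
    uniq (ct_chain s m), {subset ct_chain s m <= m} &
    if ct_chain s m is D :: u then
      [/\ (wire (last D u)).2.+1 = k, size t = (size u).+1 &
          ladder (mulw m) (wire s).1 (size u) (wire (last D u)).1]
    else t = [::]].
Proof.
move=> bm fs; have := ct_first_wire bm fs.
case E: (ct_chain s m) => [|D u].
  rewrite /ct_chain in E; case F: (ct_first s m) E => [D|] E nil; last first.
    exists [::]; rewrite addn0; split=> // i _.
    by apply: mulw_eq0 => D' /nil + e; rewrite e.
  have := ct_first_wire bm fs; rewrite F => -[Dm _ _].
  have : (0 < size (enum_mset m))%N.
    by move: Dm; rewrite -[D \in m]/(D \in enum_mset m); case: (enum_mset m).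
  by case: (size _) E.
have [-> pu] := iterates_path E; have lst := ct_chain_stop E.
case=> Dm eD min.
have [|||h1 h2 h3 h4 [h5 h6 _]] := @ct_path_wires n m (wire s).1 0 D u [::] bm Dm pu lst.
- by move=> i iD; apply: mulw_eq0 => D' /min + e; rewrite e /= => /(_ eD); lia.
- split=> //; rewrite addn0 -eD; have := mulw_gt0 Dm.
  by rewrite {1}[wire D]surjective_pairing.
- by rewrite addn0.
exists (rev [seq (wire D').1 | D' <- D :: u]).
rewrite cats0 in h3 h4; rewrite size_rev size_map /=.
have ek : ((wire s).1 + (size u).+1)%N = (wire (last D u)).2.+1 by rewrite h1; lia.
rewrite ek; split=> //.
Qed.

Lemma seg_points_iota s : framed s -> seg_points s =
  [seq o + i%:R | i <- iota (wire s).1 ((wire s).2 - (wire s).1)].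
Proof.
move=> fs; have lt := wire_lt fs; rewrite /seg_points.
have -> : seg_length s = ((wire s).2 - (wire s).1)%N.
  rewrite /seg_length seE // sbE //.
  have -> : o + (wire s).2%:R - 1 - (o + (wire s).1%:R) =
      ((wire s).2 - (wire s).1).-1%:R :> R.
    by rewrite -subn1 !natrB; [lra | lia | lia].
  by rewrite natrK; lia.
rewrite sbE // -[in RHS](addn0 (wire s).1) iotaDl addn0 -map_comp.
by apply: eq_map => i /=; rewrite natrD addrA.
Qed.

Lemma filter_iota a d l : (l <= d)%N ->
  [seq i <- iota a d | (a + l <= i)%N] = iota (a + l) (d - l).
Proof.
move=> ld; rewrite -{1}(subnKC ld) iotaD filter_cat.
rewrite (@eq_in_filter _ _ pred0) ?filter_pred0 => [|i]; last first.
  by rewrite mem_iota /=; lia.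
rewrite cat0s (@eq_in_filter _ _ predT) ?filter_predT // => i.
by rewrite mem_iota /=; lia.
Qed.

(** Under the length bound, the raised chain and the remaining points, listed in [l], have one wire
    for each point of [s]. *)
Lemma ct_op_wires n m s : bounded n m -> framed s ->
  ((wire s).1 + size (ct_chain s m) <= (wire s).2)%N ->
  (forall D u, ct_chain s m = D :: u ->
     (wire (last D u)).2.+1 = ((wire s).1 + size (D :: u))%N) ->
  uniq (ct_chain s m) -> {subset ct_chain s m <= m} ->
  let a := ((wire s).1 + size (ct_chain s m))%N in
  let l := [seq ((wire D).1, (wire D).2.+1) | D <- ct_chain s m]
           ++ [seq (i, i.+1) | i <- iota a ((wire s).2 - a)] in
  (forall q, (mulw (CT_op s m) q + count (fun D => wire D == q) (ct_chain s m) =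
    mulw m q + count (fun p => p == q) l)%N) /\
  (forall D, D \in CT_op s m -> D \in m \/ framed D /\ wire D \in l).
Proof.
move=> bm fs le elast uq sub a l; have lt := wire_lt fs.
have fm D : D \in m -> framed D := @bounded_framed n m D bm.
have le_m : seq_mset (ct_chain s m) `<=` m.
  apply/msubsetP => D'; rewrite mset_seqE count_uniq_mem //.
  by case: (boolP (D' \in _)) => // /sub; rewrite -mset_gt0.
have e1 : [seq (sb D, se D + 1) | D <- ct_chain s m] =
    map ends [seq ((wire D).1, (wire D).2.+1) | D <- ct_chain s m].
  rewrite -map_comp; apply/eq_in_map => D /sub /fm fD /=.
  by rewrite /ends /= sbE // seE // -natr1; congr pair; lra.
have e2 : [seq (j, j) | j <- ct_points s m] =
    map ends [seq (i, i.+1) | i <- iota a ((wire s).2 - a)].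
  have -> : ct_points s m = [seq o + i%:R | i <- iota a ((wire s).2 - a)].
    rewrite /ct_points /a; move: le sub elast.
    case: (ct_chain s m) => [|D u] le' sub elast; first by rewrite addn0 seg_points_iota.
    have lm : last D u \in m by apply: sub; exact: mem_last.
    rewrite seg_points_iota // filter_map subnDA -filter_iota; last by lia.
    congr map; apply: eq_filter => i /=.
    (* The end of a segment is one less than its second index, so [j > e(Theta_l) + 1] says that the
       index of [j] is at least [(wire (last D u)).2.+1], which is the first index kept. *)
    rewrite seE ?fm // subrK ltrD2l ltr_nat.
    by rewrite (elast D u erefl).
  rewrite -!map_comp; apply: eq_map => i /=.
  by rewrite /ends /= -natr1; congr pair; lra.
split=> [q|D].
  have -> : mulw m q = (mulw (m `\` seq_mset (ct_chain s m)) q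
      + count (fun D => wire D == q) (ct_chain s m))%N.
    by rewrite -mulw_seq -mulwD msetBDK.
  rewrite /CT_op e1 e2 !mulwD !mulw_segs /l count_cat.
  rewrite !count_map.
  have -> : count (preim (fun D => ((wire D).1, (wire D).2.+1))
      (fun p => (p.1 < p.2)%N && (p == q))) (ct_chain s m) =
    count (preim (fun D => ((wire D).1, (wire D).2.+1)) (fun p => p == q)) (ct_chain s m).
    by apply: eq_in_count => D /sub /fm /wire_lt; rewrite /= => D0; rewrite ltnW.
  have -> : count (preim (fun i : nat => (i, i.+1)) (fun p => (p.1 < p.2)%N && (p == q)))
      (iota a ((wire s).2 - a)) =
    count (preim (fun i : nat => (i, i.+1)) (fun p => p == q)) (iota a ((wire s).2 - a)).
    by apply: eq_count => i /=; rewrite ltnSn.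
  rewrite -!addnA; congr (_ + _)%N; rewrite [RHS]addnC -!addnA; congr (_ + _)%N.
rewrite /CT_op e1 e2 !in_msetD /l mem_cat => /orP[/orP[|/framed_segs[fD ->]]|/framed_segs[fD ->]].
- by move=> D'm; left; move: D'm; rewrite in_msetB -mset_gt0; exact: leq_ltn_trans.
- by right.
- by right; rewrite orbT.
Qed.

Lemma ct_chain_short n0 m s : bounded (wire s).2.+1 n0 -> framed s ->
  (0 < (wire s).1)%N -> Mult_le' s n0 -> m = mw_dual n0 ->
  ((wire s).1 + size (ct_chain s m) <= (wire s).2)%N.
Proof.
move=> bn fs s0 le em; have [bm _] := mw_dual_run bn; rewrite -em in bm.
have ls := wire_lt fs.
have [t [g _ uq sub]] := ct_chain_wires bm fs.
case E: (ct_chain s m) => [|D u]; first by rewrite addn0 (ltnW ls).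
case=> ek st lad; have lm : last D u \in m by apply: sub; rewrite E; exact: mem_last.
have [fl ltl] := bm _ lm; have ll := wire_lt fl.
(* If the chain is too long, [Theta_l] ends exactly where [s] does, since no segment of [m] ends
   later. *)
rewrite /= -st -ek ltnNge; apply/negP => kl.
have el : (wire (last D u)).2 = (wire s).2 by lia.
have m0 : m != mset0 by apply/eqP => m0; rewrite m0 in_mset0 in lm.
have [k [a [t' [[kn ka _ top] h gm head _]]]] := mw_step bm m0.
have k_eq : k = (wire s).2.
  have := mulw_gt0 lm; rewrite [wire _]surjective_pairing el => lpos.
  by apply/eqP; rewrite eqn_leq -ltnS kn leqNgt; apply/negP => /(top (wire (last D u)).1); lia.
rewrite {k}k_eq in kn ka top h gm head; case: gm => ak z gm.
have la : ((wire (last D u)).1 <= a)%N.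
  rewrite leqNgt; apply/negP => al; have := mulw_gt0 lm.
  by rewrite [wire _]surjective_pairing el z // al -el.
have ub : ((wire s).1 + size u = (wire s).2.-1.+1)%N by lia.
(* The ladder has one rung more than [s] has points. The first chain of [m] starts at or after the
   top rung, so it is at least as long and its head begins before [s]. *)
have ht := greedy_ladder s0 ub la lad gm.
have : (0 < mulw n0 ((wire s).2.-1 - size t', (wire s).2))%N.
  (* By involutivity [n0] is the dual of [m], hence contains the head of its first chain. *)
  by rewrite -(mw_dualK bn) -em mw_dualE // mulwD head eqxx.
case/mulw_gt0P=> D' D'n eD'; have [fD' _] := bn D' D'n.
have := le D' D'n; rewrite /seg_ge' /seg_gt' => /orP[/eqP es|].
  by move: eD'; rewrite -es => eD'; move: ub; rewrite eD' /=; lia.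
rewrite !seE // !sbE // ltrD2r ltrD2l ltr_nat (inj_eq (addIr _)) (inj_eq (addrI _)).
by rewrite eqr_nat ltrD2l ltr_nat eD' /=; lia.
Qed.

(** It suffices to exhibit a greedy chain with head [s] whose truncation turns [CT_op s m] into [m]:
    [run_triples_greedy] then compares the two duals. *)
Lemma mw_dual_ct n0 m s : bounded (wire s).2.+1 n0 -> framed s ->
  (0 < (wire s).1)%N -> Mult_le' s n0 -> m = mw_dual n0 ->
  mw_dual (CT_op s m) = T_op s (mw_dual m).
Proof.
move=> bn fs s0 le em; have short := ct_chain_short bn fs s0 le em.
have [bm _] := mw_dual_run bn; rewrite -em in bm; have ls := wire_lt fs.
have [t [g ch uq sub ec]] := ct_chain_wires bm fs.
have st : size t = size (ct_chain s m).
  by case: (ct_chain s m) ec => [->|D u []].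
have [|h1 h2] := ct_op_wires bm fs short _ uq sub.
  by move=> D u E; move: ec; rewrite E => -[-> -> _].
rewrite -st in short h1 h2; set b := ((wire s).1 + size t)%N in g ch short h1 h2.
set k := (wire s).2 in short h1 h2 bn bm ls.
have bd : (b + (k - b))%N = k by lia.
(* The remaining points of [s] prolong the chain of the [Theta_i^+] up to level [k], the end of
   [s]. *)
have gk := greedy_singles (k - b) g; rewrite bd in gk.
have bM : bounded k.+1 (CT_op s m).
  move=> D /h2[/bm//|[fD]]; rewrite mem_cat => /orP[/mapP[D' D'c ->]|/mapP[i]].
    split=> //=; rewrite ltnS -bd.
    have pos : (0 < chain_rem b t ((wire D').1, (wire D').2.+1))%N.
      by rewrite (ch _).1 -has_count; apply/hasP; exists D'.
    apply: leq_trans (leq_addr _ _); rewrite leqNgt; apply/negP => gt.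
    by rewrite chain_rem_off in pos.
  by rewrite mem_iota => hi ->; split=> //=; lia.
have [bMd rMd] := mw_dual_run bM; have [bmd rmd] := mw_dual_run bm.
(* Truncation erases the points and sends each [Theta_i^+] back to [Theta_i]. *)
have hM q : (mulw m q + chain_rem k (rev (iota b (k - b)) ++ t) q =
    mulw (CT_op s m) q + chain_add k (rev (iota b (k - b)) ++ t) q)%N.
  have := chain_rem_singles b (k - b) t q; rewrite bd => ->.
  have := chain_add_singles b (k - b) t q; rewrite bd => ->; rewrite (ch q).1 (ch q).2 h1.
  by rewrite count_cat !count_map; congr (_ + _)%N; rewrite addnC.
have gM : greedy (mulw (CT_op s m)) k k (rev (iota b (k - b)) ++ t).
  apply: greedy_le gk => // i j _; have := hM (i, j); lia.
(* The chain has as many segments as [s] has points, so its head is [s]. *)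
have size_l : size (rev (iota b (k - b)) ++ t) = (k - (wire s).1)%N.
  by rewrite size_cat size_rev size_iota; lia.
case: (rev (iota b (k - b)) ++ t) hM gM size_l => [|a t'] hM gM /= size_l; first by lia.
apply: mulw_inj => [D /bMd[]//|D|q].
  by rewrite /T_op in_msetD in_msetn /= => /orP[/bmd[]//|/eqP->].
rewrite rMd (run_triples_greedy _ _ hM gM) => [|//|i j _]; last by lia.
rewrite mulwD mulw1 -rmd; congr (_ + nat_of_bool (_ == _))%N.
by rewrite [wire s]surjective_pairing; congr pair; lia.
Qed.

End Wires.

(** * Choice of the origin and conclusion *)

Lemma exists_origin (R : realType) (c : R) (s : seg c) (m : mult c) :
  exists o : R, [/\ o - c \is a Num.int, framed o s, (0 < (wire o s).1)%N &
    forall D, D \in m -> framed o D].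
Proof.
(* The truncation is 0 when [D] begins after [s]. The successor puts [s] strictly to the right of
   the origin, the positivity that [greedy_ladder] asks for. *)
pose K := \max_(D <- m) Num.truncn (sb s - sb D); pose o := sb s - K.+1%:R.
have int_sb (D : seg c) : sb D - c \is a Num.int by case/and3P: (segP D).
have fs : framed o s by rewrite /framed /o opprB addrC subrK natr_nat.
exists o; split=> //.
- have -> : o - c = sb s - c - K.+1%:R by rewrite /o; lra.
  by rewrite rpredB ?natr_int.
- have := sbE fs; rewrite lt0n; case: eqP => // ->; rewrite addr0 /o => /eqP.
  by rewrite -subr_eq0 opprB addrC subrK pnatr_eq0.
move=> D Dm; rewrite /framed natrEint; apply/andP; split.
  have -> : sb D - o = sb D - c - (sb s - c) + K.+1%:R by rewrite /o; lra.
  by rewrite rpredD ?natr_int // rpredB.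
have le : (Num.truncn (sb s - sb D) <= K)%N by exact: leq_bigmax_seq.
have : sb s - sb D < K.+1%:R.
  by apply: lt_le_trans (truncnS_gt _) _; rewrite ler_nat.
by rewrite /o; lra.
Qed.

Theorem proposition3p1p3 (R : realType) (c : R) (s : seg c) (m : mult c) :
  DMult_le' s m -> mw_dual (CT_op s m) = T_op s (mw_dual m).
Proof.
case=> n ns ->; have [o [oc fs s0 fn]] := exists_origin s n.
(* No segment of [n] ends after [s], whence the bound [(wire s).2.+1]. *)
apply: (@mw_dual_ct R c o oc n) => // D Dn; split; first exact: fn.
have := ns D Dn; rewrite ltnS -(se_leE (fn D Dn) fs) /seg_ge' /seg_gt'.
by case/orP=> [/eqP->//|/orP[/ltW//|/andP[/eqP-> _]]].
Qed.
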